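(* Fix $L>0$. There exists $C>0$ such that the following holds. Let $f\in\mathcal C^3([0,L])$ and $\beta,\gamma\in\mathbb R$ with $\gamma-\beta+\int_0^Lf=0$. Let $\tilde u^0\in H^6(0,L)$ satisfy $\partial_x\tilde u^0(0)=\beta$, $\partial_x\tilde u^0(L)=\gamma$, $\partial_x^3\tilde u^0(0)=-\partial_xf(0)$, $\partial_x^3\tilde u^0(L)=-\partial_xf(L)$, $\partial_x^5\tilde u^0(0)=-\partial_x^3f(0)$, $\partial_x^5\tilde u^0(L)=-\partial_x^3f(L)$, and let $\tilde u$ be the solution of $\partial_t\tilde u-\partial_x^2\tilde u=f$ on $(0,L)$, $\tilde u(0,\cdot)=\tilde u^0$, $\partial_x\tilde u(t,0)=\beta$, $\partial_x\tilde u(t,L)=\gamma$. Let $J\ge2$ and $\delta t\in(0,1)$ with $\delta t/\delta x^2\le1/2$, let $\tilde{\mathsf v}^0\in\mathbb R^J$ be arbitrary, and define $\tilde{\mathsf v}^{n+1}=(\mathrm{Id}+\delta t\,\mathsf P_\delta)\tilde{\mathsf v}^n+\delta t\,\mathsf b_{\delta x}$ with $\mathsf b_{\delta x}=\Pi_{\delta x}f+\frac1{\delta x}(-\beta,0,\dots,0,\gamma)^\top+r_{\delta x}\mathbb 1$ and $r_{\delta x}=\frac1{J\delta x}\big(\int_0^Lf(x)dx-\delta x\sum_{j=0}^{J-1}f(x_j)\big)$. Then for all $n\in\mathbb N$, $$\|\Pi_{\delta x}\tilde u(n\delta t)-\tilde{\mathsf v}^n\|_{\ell^2}\le\|\Pi_{\delta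 x}\tilde u^0-\tilde{\mathsf v}^0\|_{\ell^2}+C(\delta x+\delta t)\big(\|\tilde u^0\|_{H^5}+\|f\|_{H^3}\big).$$
   Context: For $J\ge2$: $\delta x=L/(J-1)$, $x_j=j\delta x$ ($0\le j\le J-1$), $\mathbb 1=(1,\dots,1)^\top\in\mathbb R^J$, $\|\mathsf v\|_{\ell^2}^2=\frac1J\sum_j\mathsf v_j^2$, $\Pi_{\delta x}w=(w(x_j))_{0\le j\le J-1}$, and $\mathsf P_\delta=\frac1{\delta x^2}\times$ the tridiagonal $J\times J$ matrix with diagonal $(-1,-2,\dots,-2,-1)$ and off-diagonals $1$. $H^s$ norms are the standard Sobolev norms on $(0,L)$. *)

(* Defs.v *)
From HB Require Import structures.
From mathcomp Require Import all_boot all_order all_algebra.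
From mathcomp Require Import all_classical all_reals all_analysis.
Set Implicit Arguments. Unset Strict Implicit. Unset Printing Implicit Defensive.
Import Order.TTheory GRing.Theory Num.Theory.
Import numFieldNormedType.Exports.
Local Open Scope classical_set_scope.
Local Open Scope ring_scope.

Definition int_ab (R : realType) (a b : R) (g : R -> R) : R :=
  Rintegral (@lebesgue_measure R) `[a, b] g.

(* g 0 = u on [0,L] and, for i < k, g (i+1) is integrable on [0,L] and
   g i x = g i 0 + int_0^x g (i+1)  (i.e. g i is absolutely continuous with
   derivative g (i+1)); g i is "the i-th derivative of u" on [0,L]. *)
Definition deriv_chain (R : realType) (k : nat) (L : R) (u : R -> R)
  (g : nat -> R -> R) : Prop :=
  (forall x, 0 <= x <= L -> g 0%N x = u x) /\
  (forall i, (i < k)%N ->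
     (@lebesgue_measure R).-integrable `[0, L] (EFin \o g i.+1) /\
     forall x, 0 <= x <= L -> g i x = g i 0 + int_ab 0 x (g i.+1)).

(* u belongs to H^k(0,L), with (weak) derivatives g 0 = u, ..., g k;
   u is identified with its continuous representative (k >= 1). *)
Definition H_witness (R : realType) (k : nat) (L : R) (u : R -> R)
  (g : nat -> R -> R) : Prop :=
  deriv_chain k L u g /\
  measurable_fun `[0, L] (g k) /\
  (@lebesgue_measure R).-integrable `[0, L] (EFin \o (fun x => g k x ^+ 2)).

Definition C_witness (R : realType) (k : nat) (L : R) (u : R -> R)
  (g : nat -> R -> R) : Prop :=
  deriv_chain k L u g /\
  (forall i, (i <= k)%N -> {within `[0, L], continuous (g i)}).

Definition Hnorm (R : realType) (s : nat) (L : R) (g : nat -> R -> R) : R :=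
  Num.sqrt (\sum_(i < s.+1) int_ab 0 L (fun x => g i x ^+ 2)).

Definition heat_solution (R : realType) (L : R) (f : R -> R) (beta gamma : R)
  (u0 : R -> R) (u : R -> R -> R) : Prop :=
  exists ux uxx ut : R -> R -> R,
    {within [set p : R * R | 0 <= p.1 /\ 0 <= p.2 <= L],
       continuous (fun p : R * R => u p.1 p.2)} /\
    {within [set p : R * R | 0 < p.1 /\ 0 <= p.2 <= L],
       continuous (fun p : R * R => ux p.1 p.2)} /\
    {within [set p : R * R | 0 < p.1 /\ 0 <= p.2 <= L],
       continuous (fun p : R * R => uxx p.1 p.2)} /\
    {within [set p : R * R | 0 < p.1 /\ 0 <= p.2 <= L],
       continuous (fun p : R * R => ut p.1 p.2)} /\
    (forall t x : R, 0 < t -> 0 <= x <= L ->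
       u t x = u t 0 + int_ab 0 x (ux t) /\ ux t x = ux t 0 + int_ab 0 x (uxx t)) /\
    (forall t x : R, 0 < t -> 0 <= x <= L -> is_derive t 1 (fun s => u s x) (ut t x)) /\
    (forall t x : R, 0 < t -> 0 < x < L -> ut t x - uxx t x = f x) /\
    (forall x : R, 0 <= x <= L -> u 0 x = u0 x) /\
    (forall t : R, 0 < t -> ux t 0 = beta /\ ux t L = gamma).

Definition dx (R : realType) (J : nat) (L : R) : R := L / (J.-1)%:R.
Definition node (R : realType) (J : nat) (L : R) (j : nat) : R := j%:R * dx J L.

Definition Pi (R : realType) (J : nat) (L : R) (w : R -> R) : 'cV[R]_J :=
  \col_(j < J) w (node J L j).

Definition l2norm (R : realType) (J : nat) (v : 'cV[R]_J) : R :=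
  Num.sqrt (J%:R^-1 * \sum_(j < J) v j 0 ^+ 2).

Definition Pmat (R : realType) (J : nat) (L : R) : 'M[R]_J :=
  \matrix_(i < J, j < J)
    ((dx J L ^+ 2)^-1 *
     (if i == j then (if ((i : nat) == 0%N) || ((i : nat) == J.-1) then -1 else -2)
      else if ((i : nat) == (j : nat).+1) || ((j : nat) == (i : nat).+1) then 1 else 0)).

Definition rdx (R : realType) (J : nat) (L : R) (f : R -> R) : R :=
  (J%:R * dx J L)^-1 * (int_ab 0 L f - dx J L * \sum_(j < J) f (node J L j)).

Definition bvec (R : realType) (J : nat) (L : R) (f : R -> R) (beta gamma : R)
  : 'cV[R]_J :=
  \col_(j < J) (f (node J L j)
     + (dx J L)^-1 * ((if (j : nat) == 0%N then - beta else 0)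
                      + (if (j : nat) == J.-1 then gamma else 0))
     + rdx J L f).

(* Main.v *)
(* Idea. The explicit scheme is an l^2 contraction under the CFL condition, so it
   suffices to produce grid functions [W n], O(dx)-close to [u (n dt)], whose
   consistency defects [W (n+1) - W n - dt d n], [d n = P W n + b], are summable.
   [W n] is an elliptic projection: its discrete fluxes are prescribed so that
   [d n] consists of the averages of [u_t (n dt)] over [J] equal cells of width
   [L / J], each containing one node.  The O(1) consistency error of the scheme at
   the boundary nodes thereby becomes an O(dx) error on the fluxes.

   The defects only involve [u_t (t + dt) - u_t t] and [u (t + dt) - u t - dt u_t t].
   Both are limits of linear combinations of time translates of [u], i.e. of
   solutions of the homogeneous Neumann problem with zero mean, hence decay like
   [exp (- t / L^2)] by the Poincare inequality; this makes the bound uniform in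
   [n].  At [t = 0] they are estimated by comparing [u] with [u0 + t phi],
   [phi = u0'' + f]: the compatibility conditions make the difference a solution of
   the Neumann problem with source [t phi''].  No regularity of [u] beyond the
   given one is used. *)
Require Import Defs.
From HB Require Import structures.
From mathcomp Require Import all_boot all_order all_algebra.
From mathcomp Require Import all_classical all_reals all_analysis.
From mathcomp Require Import measurable_realfun ring lra zify.
Set Implicit Arguments. Unset Strict Implicit. Unset Printing Implicit Defensive.
Import Order.TTheory GRing.Theory Num.Theory.
Import numFieldNormedType.Exports.
Local Open Scope classical_set_scope.
Local Open Scope ring_scope.

(** The flux form also makes the increments of [W] small. Since [f], [beta] and the correction [r]
    do not depend on time, they cancel in [W (n+1) - W n], and what is left of the O(dx) flux error
    is multiplied by the L^1 norm of [u_t (t + dt) - u_t t]. That norm is O(dt exp (- t / L^2)), so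
    the defects add up to O(dx + dt) whatever [n] is.

    Bounding that difference amounts to bounding a second time derivative, which [u] is not known to
    have. The bound is therefore proved for second differences [U (t + h + k) - U (t + h) - U (t +
    k) + U t], which make sense without any derivative and whose size at time [t] is controlled by
    their size at time 0. They are divided by [k] before [k] tends to 0. The convergence is only
    pointwise, but Fatou's lemma suffices because only upper bounds have to survive. *)

(** * Integrals over segments of functions continuous on the whole line *)

Section Integrals.
Variable R : realType.
Implicit Types (f g h : R -> R) (a b c : R).
Notation mu := (@lebesgue_measure R).

Lemma integrable_cont g a b : continuous g -> mu.-integrable `[a, b] (EFin \o g).
Proof.
move=> cg; apply: continuous_compact_integrable; first exact: segment_compact.
exact: continuous_subspaceT.
Qed.

Lemma eq_int f g a b : (forall x, a <= x <= b -> f x = g x) ->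
  int_ab a b f = int_ab a b g.
Proof.
move=> fg; apply: eq_Rintegral => x; rewrite inE/= in_itv/=; exact: fg.
Qed.

Lemma intD f g a b : continuous f -> continuous g ->
  int_ab a b (fun x => f x + g x) = int_ab a b f + int_ab a b g.
Proof. by move=> cf cg; apply: RintegralD => //; exact: integrable_cont. Qed.

Lemma intB f g a b : continuous f -> continuous g ->
  int_ab a b (fun x => f x - g x) = int_ab a b f - int_ab a b g.
Proof. by move=> cf cg; apply: RintegralB => //; exact: integrable_cont. Qed.

Lemma intZ k f a b : continuous f ->
  int_ab a b (fun x => k * f x) = k * int_ab a b f.
Proof. by move=> cf; apply: RintegralZl => //; exact: integrable_cont. Qed.

Lemma int_cst k a b : a <= b -> int_ab a b (fun=> k) = k * (b - a).
Proof.
move=> ab; have -> : int_ab a b (fun=> k) = k * fine (mu `[a, b]).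
  exact: (Rintegral_cst mu (measurable_itv _)).
rewrite lebesgue_measure_itv/= lte_fin.
move: ab; rewrite le_eqVlt => /predU1P[->|->]; last by [].
by rewrite ltxx subrr.
Qed.

Lemma le_int f g a b : continuous f -> continuous g ->
  (forall x, a <= x <= b -> f x <= g x) -> int_ab a b f <= int_ab a b g.
Proof.
move=> cf cg fg; apply: le_Rintegral; [by []|exact: integrable_cont..|].
by move=> x; rewrite /= in_itv/=; exact: fg.
Qed.

Lemma int_ge0 f a b : (forall x, a <= x <= b -> 0 <= f x) -> 0 <= int_ab a b f.
Proof.
by move=> f0; apply: Rintegral_ge0 => x; rewrite /= in_itv/=; exact: f0.
Qed.

Lemma cont_norm f : continuous f -> continuous (fun x => `|f x|).
Proof. by move=> cf x; apply: cvg_norm; exact: cf. Qed.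

Lemma cont_sqr f : continuous f -> continuous (fun x => f x ^+ 2).
Proof. by move=> cf x; exact: (cvgM (cf x) (cf x)). Qed.

Lemma cont_mul f g : continuous f -> continuous g ->
  continuous (fun x => f x * g x).
Proof. by move=> cf cg x; apply: cvgM; [exact: cf|exact: cg]. Qed.

Lemma cont_add f g : continuous f -> continuous g ->
  continuous (fun x => f x + g x).
Proof. by move=> cf cg x; apply: cvgD; [exact: cf|exact: cg]. Qed.

Lemma cont_sub f g : continuous f -> continuous g ->
  continuous (fun x => f x - g x).
Proof. by move=> cf cg x; apply: cvgB; [exact: cf|exact: cg]. Qed.

Lemma cont_scale k f : continuous f -> continuous (fun x => k * f x).
Proof. by move=> cf x; apply: cvgM; [exact: cvg_cst|exact: cf]. Qed.

Lemma le_norm_int f a b : continuous f ->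
  `|int_ab a b f| <= int_ab a b (fun x => `|f x|).
Proof. by move=> cf; apply: le_normr_Rintegral => //; exact: integrable_cont. Qed.

Lemma int_split f a c b : continuous f -> a <= c -> c <= b ->
  int_ab a b f = int_ab a c f + int_ab c b f.
Proof.
move=> cf ac cb; apply/eqP; rewrite addrC -subr_eq; apply/eqP.
rewrite /int_ab.
have := @Rintegral_itvB _ f (BLeft a) (BRight b) c (integrable_cont a b cf).
rewrite !bnd_simp => /(_ ac cb) ->.
rewrite Rintegral_itv_obnd_cbnd//.
apply: (integrableS _ _ _ (integrable_cont c b cf)) => //.
by apply: subset_itvr; rewrite bnd_simp.
Qed.

Lemma int_pt f a : int_ab a a f = 0.
Proof. by rewrite /int_ab set_itv1 Rintegral_set1. Qed.

(** The endpoints are negligible. The heat equation holds only at interior points, so integrands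
    have to be compared there. *)
Lemma le_int_oo f g a b : continuous f -> continuous g -> a <= b ->
  (forall x, a < x < b -> f x <= g x) -> int_ab a b f <= int_ab a b g.
Proof.
move=> cf cg ab fg.
have E k : continuous k -> int_ab a b k = \int[mu]_(x in `]a, b[) k x.
  move=> ck; rewrite /int_ab -Rintegral_itv_obnd_cbnd.
    rewrite Rintegral_itv_bndo_bndc//.
    by apply: (integrableS _ _ _ (integrable_cont a b ck)) => //; exact: subset_itv_oo_cc.
  by apply: (integrableS _ _ _ (integrable_cont a b ck)) => //; exact: subset_itv_oc_cc.
rewrite !E//; apply: le_Rintegral => //.
- by apply: (integrableS _ _ _ (integrable_cont a b cf)) => //; exact: subset_itv_oo_cc.
- by apply: (integrableS _ _ _ (integrable_cont a b cg)) => //; exact: subset_itv_oo_cc.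
Qed.

Lemma eq_int_oo f g a b : continuous f -> continuous g -> a <= b ->
  (forall x, a < x < b -> f x = g x) -> int_ab a b f = int_ab a b g.
Proof.
by move=> cf cg ab fg; apply/eqP; rewrite eq_le !le_int_oo// => x /fg ->.
Qed.

Lemma int_mono f a b a' b' : continuous f -> (forall x, a <= x <= b -> 0 <= f x) ->
  a <= a' -> a' <= b' -> b' <= b -> int_ab a' b' f <= int_ab a b f.
Proof.
move=> cf f0 aa' ab' bb'.
rewrite (@int_split _ a a' b)// ?(le_trans ab')//.
rewrite (@int_split _ a' b' b)//.
have h1 : 0 <= int_ab a a' f.
  apply: int_ge0 => x /andP[ax xa]; apply: f0.
  by rewrite ax (le_trans xa)// (le_trans ab').
have h2 : 0 <= int_ab b' b f.
  by apply: int_ge0 => x /andP[ax xa]; apply: f0; rewrite xa (le_trans _ ax)// (le_trans aa').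
lra.
Qed.

(** Cauchy-Schwarz against the constant 1, read off from a variance: integrate [(|f| - m)^2 >= 0]
    with [m] the mean of [|f|]. *)
Lemma int_CS f a b : continuous f -> a <= b ->
  (int_ab a b (fun x => `|f x|)) ^+ 2 <= (b - a) * int_ab a b (fun x => f x ^+ 2).
Proof.
move=> cf ab.
have caf := cont_norm cf; have csf := cont_sqr cf.
set A := int_ab a b (fun x => `|f x|); set B := int_ab a b (fun x => f x ^+ 2).
have B0 : 0 <= B by apply: int_ge0 => x _; exact: sqr_ge0.
move: ab; rewrite le_eqVlt => /predU1P[ab|ab].
  by rewrite /A ab int_pt subrr mul0r expr0n.
have ba : 0 < b - a by lra.
pose m := A / (b - a).
have : 0 <= int_ab a b (fun x => f x ^+ 2 - ((2 * m) * `|f x| - m ^+ 2)).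
  apply: int_ge0 => x _; rewrite -(real_normK (num_real (f x))).
  have := sqr_ge0 (`|f x| - m); nra.
rewrite intB//; last first.
  by apply: cont_sub; [exact: cont_scale|move=> ?; exact: cvg_cst].
rewrite intB//; [|exact: cont_scale|move=> ?; exact: cvg_cst].
rewrite intZ// int_cst ?(ltW ab)// -/A -/B.
have -> : B - (2 * m * A - m ^+ 2 * (b - a)) = B - A ^+ 2 / (b - a).
  by rewrite /m; field; rewrite gt_eqF.
by rewrite subr_ge0 ler_pdivrMr// mulrC.
Qed.

Lemma FTC2 F f a b : a <= b -> continuous F -> continuous f ->
  (forall x, a < x < b -> is_derive x 1 F (f x)) ->
  int_ab a b f = F b - F a.
Proof.
rewrite le_eqVlt => /predU1P[->|ab cF cf dF]; first by rewrite int_pt subrr.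
have := @continuous_FTC2 _ f F a b ab (continuous_subspaceT cf).
rewrite /int_ab /Rintegral => ->//.
  split; first by move=> x; rewrite in_itv/= => /dF[].
    by apply: cvg_at_right_filter; exact: cF.
  by apply: cvg_at_left_filter; exact: cF.
by move=> x; rewrite in_itv/= => /dF[? <-]; rewrite derive1E.
Qed.

Lemma derive_int f a b x : continuous f -> a < x < b ->
  is_derive x 1 (fun y => int_ab a y f) (f x).
Proof.
move=> cf /andP[ax xb].
have [d1 d2] := @continuous_FTC1_closed _ f a x b xb (integrable_cont a b cf) ax (cf x).
by split=> //; rewrite -derive1E.
Qed.

End Integrals.

(** * Clamping, parameter integrals and Gronwall's inequality *)

Section Tools.
Variable R : realType.
Implicit Types (f g p P : R -> R) (a b L : R).
Notation mu := (@lebesgue_measure R).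

Definition clamp L (x : R) : R := Num.max 0 (Num.min x L).

Lemma clamp_id L x : 0 <= x <= L -> clamp L x = x.
Proof. by move=> /andP[x0 xL]; rewrite /clamp min_l// max_r. Qed.

Lemma clamp_in L x : 0 <= L -> 0 <= clamp L x <= L.
Proof.
by move=> L0; rewrite /clamp le_max lexx/= ge_max L0 ge_min lexx orbT.
Qed.

Lemma clamp_cont L : continuous (clamp L).
Proof.
move=> x; apply: (@continuous_max R _ (fun=> 0) (fun y => Num.min y L)).
  exact: cvg_cst.
by apply: (@continuous_min R _ id (fun=> L)); [exact: cvg_id|exact: cvg_cst].
Qed.

(** Turns continuity within [A] into ordinary continuity: [k] sends a whole neighbourhood of [x]
    into [A], so the restriction to [A] becomes invisible. It is applied with [k] a clamping map. *)
Lemma within_comp (T U V : topologicalType) (A : set U) (g : U -> V) (k : T -> U) x :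
  {within A, continuous g} -> {for x, continuous k} ->
  (\forall y \near x, A (k y)) -> {for x, continuous (g \o k)}.
Proof.
move=> /subspace_continuousP cg ck Ak.
have Akx := nbhs_singleton Ak.
move=> B /(cg _ Akx); rewrite /within /= => nB.
have nB' := ck _ nB.
by apply: (@filterS2 _ (nbhs x) (nbhs_filter x) _ _ _ _ Ak nB') => y Aky; exact.
Qed.

Lemma continuous_pair (T U V : topologicalType) (f : T -> U) (g : T -> V) x :
  {for x, continuous f} -> {for x, continuous g} ->
  {for x, continuous (fun y => (f y, g y))}.
Proof. by move=> cf cg; apply: (@cvg_pair _ _ _ _ (nbhs (f x)) (nbhs (g x))). Qed.

Lemma continuous_sect1 (G : R -> R -> R) t x :
  {for (t, x), continuous (fun q : R * R => G q.1 q.2)} -> {for x, continuous (G t)}.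
Proof.
move=> cG; apply: (@continuous_comp _ _ _ (fun x => (t, x)) (fun q : R * R => G q.1 q.2)) => //.
by apply: continuous_pair; [exact: cvg_cst|exact: cvg_id].
Qed.

Lemma continuous_sect2 (G : R -> R -> R) t x :
  {for (t, x), continuous (fun q : R * R => G q.1 q.2)} -> {for t, continuous (G ^~ x)}.
Proof.
move=> cG; apply: (@continuous_comp _ _ _ (fun t => (t, x)) (fun q : R * R => G q.1 q.2)) => //.
by apply: continuous_pair; [exact: cvg_id|exact: cvg_cst].
Qed.

Lemma cont_clamp L g : 0 <= L -> {within `[0, L], continuous g} ->
  continuous (fun x => g (clamp L x)).
Proof.
move=> L0 cg x; apply: (@within_comp R R R `[0, L]%classic g (clamp L)) => //.
  exact: clamp_cont.
by apply: (@filterE _ _ (nbhs_filter x)) => y; rewrite /= in_itv/=; exact: clamp_in.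
Qed.

Lemma derive_primitive P p a b x : continuous p ->
  (forall y, a <= y <= b -> P y = P a + int_ab a y p) ->
  a < x < b -> is_derive x 1 P (p x).
Proof.
move=> cp Pp axb.
have dI := derive_int cp axb.
have dQ : is_derive x 1 (fun y => P a + int_ab a y p) (p x).
  have -> : p x = 0 + p x by rewrite add0r.
  exact: is_deriveD.
apply: (near_eq_is_derive _ dQ).
have : \forall y \near x, y \in `]a, b[ by apply: near_in_itvoo; rewrite in_itv.
apply: filterS => y; rewrite in_itv/= => /andP[ay yb].
by rewrite -Pp// !ltW.
Qed.

(** Compactness of the rectangle supplies the constant dominating function needed for continuity and
    differentiation under the integral sign. *)
Lemma continuous_rect_bounded (G : R -> R -> R) (a b c d : R) :
  (forall t x : R, a <= t <= b -> c <= x <= d ->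
     {for (t, x), continuous (fun q : R * R => G q.1 q.2)}) ->
  exists M, 0 <= M /\ forall t x : R, a <= t <= b -> c <= x <= d -> `|G t x| <= M.
Proof.
move=> cG.
have cK : compact (`[a, b]%classic `*` `[c, d]%classic : set (R * R)).
  by apply: compact_setX; exact: segment_compact.
have /compact_bounded : compact ((fun q : R * R => G q.1 q.2) @`
    (`[a, b]%classic `*` `[c, d]%classic)).
  apply: continuous_compact => //.
  apply: continuous_in_subspaceT => q; rewrite inE => -[/=].
  by case: q => t x /=; rewrite !in_itv/=; exact: cG.
move=> [M [_ MG]].
exists (Num.max 0 (M + 1)); split; first by rewrite le_max lexx.
move=> t x tab xcd.
have lM : M < Num.max 0 (M + 1) by rewrite lt_max ltrDl ltr01 orbT.
have HI : ((fun q : R * R => G q.1 q.2) @` (`[a, b]%classic `*` `[c, d]%classic)) (G t x).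
  by exists (t, x) => //; split; rewrite /= in_itv.
exact: (MG _ lM _ HI).
Qed.

Lemma int_continuous (G : R -> R -> R) a b :
  continuous (fun q : R * R => G q.1 q.2) ->
  continuous (fun t => int_ab a b (G t)).
Proof.
move=> cG t.
have cGt s : continuous (G s) by move=> x; apply: continuous_sect1; exact: cG.
have cGx x : continuous (G ^~ x) by move=> s; apply: continuous_sect2; exact: cG.
have [M [M0 GM]] := @continuous_rect_bounded G (t - 1) (t + 1) a b (fun _ _ _ _ => cG _).
have := @continuity_under_integral R _ _ mu G `[a, b]%classic (measurable_itv _)
  (t - 1) (t + 1) _ _ (fun=> M) _ _.
apply => //.
- by move=> s _; exact: integrable_cont.
- by apply: aeW => x _ s _; exact: cGx.
- by apply: integrable_cont => ?; exact: cvg_cst.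
- move=> s; rewrite /= in_itv/= => /andP[/ltW s1 /ltW s2]; apply: aeW => x.
  by rewrite /= in_itv/= => xab; apply: GM => //; rewrite s1.
- by rewrite inE/= in_itv/=; apply/andP; split; lra.
Qed.

Lemma is_derive_int (G Gt : R -> R -> R) (a b t : R) : 0 < t ->
  (forall s : R, 0 < s -> continuous (G s)) ->
  (forall s x : R, 0 < s -> is_derive s 1 (G ^~ x) (Gt s x)) ->
  (forall s x : R, 0 < s -> {for (s, x), continuous (fun q : R * R => Gt q.1 q.2)}) ->
  is_derive t 1 (fun s => int_ab a b (G s)) (int_ab a b (Gt t)).
Proof.
move=> t0 cG dG cGt.
(* The time window [[t / 2, t + 1]] stays away from 0, near which [Gt] may be unbounded. *)
have [|M [M0 GM]] := @continuous_rect_bounded Gt (t / 2) (t + 1) a b.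
  by move=> s x /andP[ts _] _; apply: cGt; lra.
have It : `](t / 2), (t + 1)[%classic t by rewrite /= in_itv/=; apply/andP; split; lra.
have I0 s : `](t / 2), (t + 1)[%classic s -> 0 < s.
  by rewrite /= in_itv/= => /andP[ts _]; lra.
have pE s x : 0 < s -> partial1of2 G s x = Gt s x.
  by move=> s0; rewrite partial1of2E; have [] := dG s x s0.
have intf s : `](t / 2), (t + 1)[%classic s -> mu.-integrable `[a, b] (EFin \o G s).
  by move=> /I0 s0; apply: integrable_cont; exact: cG.
have derf s x : `](t / 2), (t + 1)[%classic s -> `[a, b]%classic x -> derivable (G ^~ x) s 1.
  by move=> /I0 s0 _; have [] := dG s x s0.
have bnd s x : `](t / 2), (t + 1)[%classic s -> `[a, b]%classic x -> `|partial1of2 G s x| <= M.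
  move=> Is; rewrite pE; last exact: I0.
  rewrite /= in_itv/= => xab; apply: GM => //.
  by move: Is; rewrite /= in_itv/= => /andP[/ltW -> /ltW ->].
have intM : mu.-integrable `[a, b] (EFin \o (fun=> M)).
  by apply: integrable_cont => ?; exact: cvg_cst.
split.
  exact: (@derivable_under_integral R _ _ mu G `[a, b]%classic (measurable_itv _)
    t _ _ It intf derf (fun=> M)).
rewrite -derive1E.
rewrite (@differentiation_under_integral R _ _ mu G `[a, b]%classic (measurable_itv _)
  t _ _ It intf derf (fun=> M))//.
by apply: eq_Rintegral => x _; exact: pE.
Qed.

(** By the mean value theorem [expR (- k * t) * E t] does not increase. Composing with [Num.max 0]
    expresses continuity on the closed half-line as continuity of a total function. The rate [k] may
    have any sign: it is used with [1 / tau], 0 and [- 2 / L^2]. *)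
Lemma gronwall (E E' : R -> R) (k tau : R) : 0 <= tau ->
  continuous (fun t : R => E (Num.max 0 t)) ->
  (forall t : R, 0 < t < tau -> is_derive t 1 E (E' t)) ->
  (forall t : R, 0 < t < tau -> E' t <= k * E t) ->
  E tau <= expR (k * tau) * E 0.
Proof.
rewrite le_eqVlt => /predU1P[<-|tau0] cE dE leE.
  by rewrite mulr0 expR0 mul1r.
pose H (t : R) := expR (- k * t) * E (Num.max 0 t).
have dH (t : R) : t \in `]0, tau[ ->
    is_derive t 1 H (expR (- k * t) * (E' t - k * E t)).
  rewrite in_itv/= => t0; have dEt := dE t t0.
  have dM : is_derive t 1 (fun t : R => E (Num.max 0 t)) (E' t).
    apply: (near_eq_is_derive _ dEt).
    have : \forall y \near t, y \in `]0, tau[ by apply: near_in_itvoo; rewrite in_itv.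
    by apply: filterS => y; rewrite in_itv/= => /andP[y0 _]; rewrite max_r// ltW.
  have dX : is_derive t 1 (fun t : R => expR (- k * t)) (- k * expR (- k * t)).
    have h : is_derive t 1 (fun t : R => - k * t) (- k).
      by apply: is_derive_eq; rewrite scaler1/=.
    have := @is_derive1_comp _ _ _ t _ _ (is_derive_expR (- k * t)) h.
    by rewrite mulrC.
  apply: is_derive_eq; rewrite max_r; last by case/andP: t0 => /ltW.
  by rewrite /GRing.scale/=; ring.
have cH : {within `[0, tau], continuous H}.
  apply: continuous_subspaceT; apply: cont_mul => // x.
  apply: (@continuous_comp _ _ _ (fun t : R => - k * t) expR); last exact: continuous_expR.
  by apply: cvgM; [exact: cvg_cst|exact: cvg_id].
have [c ctau HE] := MVT tau0 dH cH.
have : H tau <= H 0.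
  rewrite -subr_le0 HE pmulr_lle0; last by rewrite subr0.
  rewrite pmulr_rle0 ?expR_gt0// subr_le0; apply: leE.
  by move: ctau; rewrite in_itv.
rewrite /H mulr0 expR0 mul1r maxxx (max_r (ltW tau0)) => h.
have -> : E tau = expR (k * tau) * (expR (- k * tau) * E tau).
  by rewrite mulrA -expRD mulNr subrr expR0 mul1r.
by rewrite ler_pM2l// expR_gt0.
Qed.

End Tools.

(** * Energy, mean and decay estimates for the Neumann problem *)

Section Heat.
Variable R : realType.
Variable L : R.
Hypothesis L0 : 0 < L.
Implicit Types (z zx zxx zt F : R -> R -> R) (psi : R -> R).

(* [z] solves [z_t - z_xx = F] on [(0, L)] for [t > 0], with Neumann data [b0], [b1].
   All functions of [x] are total and continuous on the whole line: they are meant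
   to be composed with [clamp L], which spares the subspace topologies. *)
Record neumann_heat (b0 b1 : R) z zx zxx zt F : Prop := NeumannHeat {
  nh_cont : continuous (fun q : R * R => z (Num.max 0 q.1) q.2);
  nh_cx : forall t : R, 0 < t -> continuous (zx t);
  nh_cxx : forall t : R, 0 < t -> continuous (zxx t);
  nh_ct : forall t x : R, 0 < t -> {for (t, x), continuous (fun q : R * R => zt q.1 q.2)};
  nh_x : forall t x : R, 0 < t -> 0 <= x <= L -> z t x = z t 0 + int_ab 0 x (zx t);
  nh_xx : forall t x : R, 0 < t -> 0 <= x <= L -> zx t x = b0 + int_ab 0 x (zxx t);
  nh_b1 : forall t : R, 0 < t -> zx t L = b1;
  nh_t : forall t x : R, 0 < t -> is_derive t 1 (z ^~ x) (zt t x);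
  nh_eq : forall t x : R, 0 < t -> 0 < x < L -> zt t x - zxx t x = F t x }.

Arguments nh_cont {b0 b1 z zx zxx zt F} _ _.

Lemma nh_cz b0 b1 z zx zxx zt F : neumann_heat b0 b1 z zx zxx zt F ->
  forall t : R, 0 <= t -> continuous (z t).
Proof.
move=> H t t0 x; have := @continuous_sect1 _ (fun s y => z (Num.max 0 s) y) t x (nh_cont H (t, x)).
by rewrite /= max_r.
Qed.

Lemma nh_czt b0 b1 z zx zxx zt F : neumann_heat b0 b1 z zx zxx zt F ->
  forall t : R, 0 < t -> continuous (zt t).
Proof. by move=> H t t0 x; apply: (@continuous_sect1 _ zt t x); exact: (nh_ct H). Qed.

Lemma neumann_heat_lin b0 b1 z zx zxx zt F b0' b1' z' zx' zxx' zt' F' k k' :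
  neumann_heat b0 b1 z zx zxx zt F -> neumann_heat b0' b1' z' zx' zxx' zt' F' ->
  neumann_heat (k * b0 + k' * b0') (k * b1 + k' * b1')
    (fun t x => k * z t x + k' * z' t x)
    (fun t x => k * zx t x + k' * zx' t x)
    (fun t x => k * zxx t x + k' * zxx' t x)
    (fun t x => k * zt t x + k' * zt' t x)
    (fun t x => k * F t x + k' * F' t x).
Proof.
move=> H H'; split.
- move=> q; apply: cvgD; (apply: cvgM; first exact: cvg_cst).
    exact: (nh_cont H).
  exact: (nh_cont H').
- by move=> t t0; apply: cont_add; apply: cont_scale; [exact: (nh_cx H)|exact: (nh_cx H')].
- by move=> t t0; apply: cont_add; apply: cont_scale; [exact: (nh_cxx H)|exact: (nh_cxx H')].
- move=> t x t0; apply: cvgD; (apply: cvgM; first exact: cvg_cst).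
    exact: (nh_ct H).
  exact: (nh_ct H').
- move=> t x t0 xL; rewrite (nh_x H)// (nh_x H' t0 xL).
  have c := nh_cx H t0; have c' := nh_cx H' t0.
  by rewrite intD ?intZ//; [ring|exact: cont_scale..].
- move=> t x t0 xL; rewrite (nh_xx H)// (nh_xx H' t0 xL).
  have c := nh_cxx H t0; have c' := nh_cxx H' t0.
  by rewrite intD ?intZ//; [ring|exact: cont_scale..].
- by move=> t t0; rewrite (nh_b1 H)// (nh_b1 H').
- move=> t x t0; have d := nh_t H x t0; have d' := nh_t H' x t0.
  by apply: is_derive_eq; rewrite /GRing.scale/=; ring.
- move=> t x t0 xL; rewrite -(nh_eq H)// -(nh_eq H')//; ring.
Qed.

Lemma neumann_heat_shift b0 b1 z zx zxx zt F s : 0 <= s ->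
  neumann_heat b0 b1 z zx zxx zt F ->
  neumann_heat b0 b1 (fun t => z (t + s)) (fun t => zx (t + s)) (fun t => zxx (t + s))
    (fun t => zt (t + s)) (fun t => F (t + s)).
Proof.
move=> s0 H.
have ts (t : R) : 0 < t -> 0 < t + s by move=> t0; rewrite ltr_wpDr.
split.
- have -> : (fun q : R * R => z (Num.max 0 q.1 + s) q.2) =
    (fun q : R * R => z (Num.max 0 q.1) q.2) \o (fun q : R * R => (Num.max 0 q.1 + s, q.2)).
    by apply/funext => q /=; rewrite (@max_r _ _ 0 (_ + s))// addr_ge0// le_max lexx.
  move=> q; apply: continuous_comp; last exact: (nh_cont H).
  apply: (@continuous_pair _ _ _ (fun q : R * R => Num.max 0 q.1 + s)
    (fun q : R * R => q.2)); last exact: cvg_snd.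
  apply: cvgD; last exact: cvg_cst.
  by apply: (@continuous_max R _ (fun=> 0) (fun q : R * R => q.1)); [exact: cvg_cst|exact: cvg_fst].
- by move=> t t0; apply: (nh_cx H); exact: ts.
- by move=> t t0; apply: (nh_cxx H); exact: ts.
- move=> t x t0.
  apply: (@continuous_comp _ _ _ (fun q : R * R => (q.1 + s, q.2)) (fun q : R * R => zt q.1 q.2)).
    apply: (@continuous_pair _ _ _ (fun q : R * R => q.1 + s)
      (fun q : R * R => q.2)); last exact: cvg_snd.
    by apply: cvgD; [exact: cvg_fst|exact: cvg_cst].
  by apply: (nh_ct H); exact: ts.
- by move=> t x t0; apply: (nh_x H); exact: ts.
- by move=> t x t0; apply: (nh_xx H); exact: ts.
- by move=> t t0; apply: (nh_b1 H); exact: ts.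
- move=> t x t0; have d := nh_t H x (ts _ t0).
  have d2 : is_derive t 1 (fun r : R => r + s) 1.
    by apply: is_derive_eq; rewrite addr0.
  have := @is_derive1_comp _ _ _ t _ _ d d2.
  by rewrite mulr1.
- by move=> t x t0 xL; apply: (nh_eq H) => //; exact: ts.
Qed.

Definition sqint (g : R -> R) := int_ab 0 L (fun x => g x ^+ 2).

Lemma sqint_ge0 g : 0 <= sqint g.
Proof. by apply: int_ge0 => x _; exact: sqr_ge0. Qed.

Lemma sqint_cont b0 b1 z zx zxx zt F : neumann_heat b0 b1 z zx zxx zt F ->
  continuous (fun t : R => sqint (z (Num.max 0 t))).
Proof.
move=> H; apply: (@int_continuous _ (fun t x => z (Num.max 0 t) x ^+ 2)).
move=> q; exact: (cvgM (nh_cont H q) (nh_cont H q)).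
Qed.

Lemma sqint_derive b0 b1 z zx zxx zt F : neumann_heat b0 b1 z zx zxx zt F ->
  forall t : R, 0 < t ->
  is_derive t 1 (fun t => sqint (z t)) (int_ab 0 L (fun x => 2 * (z t x * zt t x))).
Proof.
move=> H t t0.
apply: (@is_derive_int _ (fun s x => z s x ^+ 2) (fun s x => 2 * (z s x * zt s x))) => //.
- by move=> s s0; apply: cont_sqr; apply: (nh_cz H); exact: ltW.
- move=> s x s0; have d := nh_t H x s0.
  by apply: is_derive_eq; rewrite /GRing.scale/=; ring.
- move=> s x s0; apply: cvgM; first exact: cvg_cst.
  apply: cvgM; last exact: (nh_ct H).
  have h := nh_cont H (s, x); rewrite /continuous_at /= max_r ?(ltW s0)// in h.
  apply: cvg_trans h; apply: near_eq_cvg.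
  have h1 : \forall q \near ((s, x) : R * R), q.1 \in `]0, (s + 1)[.
    have cf : {for ((s, x) : R * R), continuous (fun q : R * R => q.1)} by exact: cvg_fst.
    have Is : s \in `]0, (s + 1)[ by rewrite in_itv/= s0 ltrDl ltr01.
    exact: (cf _ (near_in_itvoo Is)).
  by apply: filterS h1 => q; rewrite in_itv/= => /andP[q0 _]; rewrite max_r// ltW.
Qed.

(* Integration by parts; the Neumann conditions kill the boundary terms. *)
Lemma int_z_zxx z zx zxx zt F : neumann_heat 0 0 z zx zxx zt F ->
  forall t : R, 0 < t -> int_ab 0 L (fun x => z t x * zxx t x) = - sqint (zx t).
Proof.
move=> H t t0.
have cz := nh_cz H (ltW t0); have cx := nh_cx H t0; have cxx := nh_cxx H t0.
apply/eqP; rewrite -addr_eq0; apply/eqP.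
rewrite /sqint -intD; [|exact: cont_mul|exact: cont_sqr].
set I := int_ab _ _ _.
suff -> : I = z t L * zx t L - z t 0 * zx t 0.
  have zx0 : zx t 0 = 0 by rewrite (nh_xx H)// ?int_pt ?addr0// lexx ltW.
  by rewrite (nh_b1 H)// zx0; ring.
apply: (@FTC2 _ (fun x => z t x * zx t x)); rewrite ?(ltW L0)//.
- exact: cont_mul.
- by apply: cont_add; [exact: cont_mul|exact: cont_sqr].
- move=> x xL.
  have d1 : is_derive x 1 (z t) (zx t x).
    by apply: derive_primitive xL => // y yL; exact: (nh_x H).
  have d2 : is_derive x 1 (zx t) (zxx t x).
    apply: derive_primitive xL => // y yL.
    have zx0 : zx t 0 = 0 by rewrite (nh_xx H)// ?int_pt ?addr0// lexx ltW.
    by rewrite zx0; exact: (nh_xx H).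
  by apply: is_derive_eq; rewrite /GRing.scale/=; ring.
Qed.

(** The derivative of the energy is [- 2 |z_x|^2 + 2 <z, F>], and Young's inequality with weight
    [tau] bounds the last term by [|z|^2 / tau + tau |F|^2]. Gronwall with rate [1 / tau] on an
    interval of length [tau] then costs only the factor [expR 1], while a source of size [sigma]
    contributes [tau^2 sigma^2] and no lower power of [tau]. *)
Lemma heat_energy z zx zxx zt F psi sigma tau : neumann_heat 0 0 z zx zxx zt F ->
  continuous psi -> 0 < tau ->
  (forall t x : R, 0 < t < tau -> 0 < x < L -> F t x ^+ 2 <= sigma ^+ 2 * psi x ^+ 2) ->
  sqint (z tau) <= expR 1 * (sqint (z 0) + tau ^+ 2 * sigma ^+ 2 * sqint psi).
Proof.
move=> H cpsi tau0 FM.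
(* Adding the constant [K] makes the inequality homogeneous, since [K / tau] is the source term
   [tau * sigma ^+ 2 * sqint psi]. *)
set K := tau ^+ 2 * sigma ^+ 2 * sqint psi.
have K0 : 0 <= K by apply: mulr_ge0; [apply: mulr_ge0; exact: sqr_ge0|exact: sqint_ge0].
have := @gronwall _ (fun t : R => sqint (z t) + K)
  (fun t => int_ab 0 L (fun x => 2 * (z t x * zt t x))) tau^-1 tau (ltW tau0).
rewrite mulVf ?gt_eqF// => g.
have {g} : sqint (z tau) + K <= expR 1 * (sqint (z 0) + K).
  apply: g.
  - by apply: cont_add; [exact: sqint_cont H|move=> ?; exact: cvg_cst].
  - move=> t /andP[t0 _]; have d := sqint_derive H t0.
    by apply: is_derive_eq; rewrite addr0.
  move=> t ttau; have /andP[t0 _] := ttau.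
  have cz := nh_cz H (ltW t0); have czt := nh_czt H t0; have cxx := nh_cxx H t0.
  rewrite mulrDr.
  have -> : tau^-1 * K = (tau * sigma ^+ 2) * sqint psi.
    by rewrite /K; field; rewrite gt_eqF.
  rewrite /sqint -!intZ; [|exact: cont_sqr..].
  rewrite -intD; [|by apply: cont_scale; exact: cont_sqr..].
  set A := fun x => tau^-1 * z t x ^+ 2 + tau * sigma ^+ 2 * psi x ^+ 2.
  have cA : continuous A by apply: cont_add; apply: cont_scale; exact: cont_sqr.
  have : int_ab 0 L (fun x => 2 * (z t x * zt t x)) <=
      int_ab 0 L (fun x => A x + 2 * (z t x * zxx t x)).
    apply: le_int_oo; rewrite ?(ltW L0)//.
    - by apply: cont_scale; exact: cont_mul.
    - by apply: cont_add => //; apply: cont_scale; exact: cont_mul.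
    move=> x xL; rewrite -lerBlDr.
    have -> : 2 * (z t x * zt t x) - 2 * (z t x * zxx t x) = 2 * (z t x * F t x).
      by rewrite -(nh_eq H)//; ring.
    have : tau * F t x ^+ 2 <= tau * (sigma ^+ 2 * psi x ^+ 2).
      by rewrite ler_pM2l// FM.
    have : 0 <= tau^-1 * (z t x - tau * F t x) ^+ 2.
      by rewrite mulr_ge0 ?sqr_ge0// invr_ge0 ltW.
    have -> : tau^-1 * (z t x - tau * F t x) ^+ 2 =
        tau^-1 * z t x ^+ 2 - 2 * (z t x * F t x) + tau * F t x ^+ 2.
      by field; rewrite gt_eqF.
    rewrite /A; lra.
  rewrite intD//; last by apply: cont_scale; exact: cont_mul.
  rewrite (@intZ _ 2 (fun x => z t x * zxx t x)); last exact: cont_mul.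
  rewrite (int_z_zxx H)//.
  have := sqint_ge0 (zx t); lra.
have : 1 <= expR 1 :> R by rewrite -[leLHS]expR0 ler_expR.
lra.
Qed.

(** Constancy is obtained from [gronwall] with rate 0, applied to the mean and to its opposite,
    because the derivative is available only for positive times. *)
Lemma heat_mean b0 b1 z zx zxx zt F : neumann_heat b0 b1 z zx zxx zt F ->
  (forall t : R, 0 < t -> int_ab 0 L (zt t) = 0) ->
  forall t : R, 0 <= t -> int_ab 0 L (z t) = int_ab 0 L (z 0).
Proof.
move=> H zt0 t t0.
have d (s : R) : 0 < s -> is_derive s 1 (fun s : R => int_ab 0 L (z s)) 0.
  move=> s0.
  suff h : is_derive s 1 (fun r : R => int_ab 0 L (z r)) (int_ab 0 L (zt s)).
    by apply: is_derive_eq; exact: zt0.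
  apply: is_derive_int => //.
  - by move=> r r0; apply: (nh_cz H); exact: ltW.
  - by move=> r x r0; exact: (nh_t H).
  - by move=> r x r0; exact: (nh_ct H).
have c : continuous (fun t : R => int_ab 0 L (z (Num.max 0 t))).
  exact: (@int_continuous _ (fun (t x : R) => z (Num.max 0 t) x) 0 L (nh_cont H)).
apply/eqP; rewrite eq_le; apply/andP; split.
  have := @gronwall _ (fun s : R => int_ab 0 L (z s)) (fun=> 0) 0 t t0 c.
  rewrite mul0r expR0 mul1r; apply; first by move=> s /andP[s0 _]; exact: d.
  by move=> s _; rewrite mul0r.
have := @gronwall _ (fun s : R => - int_ab 0 L (z s)) (fun=> 0) 0 t t0.
rewrite mul0r expR0 mul1r lerN2; apply.
- by move=> s; apply: cvgN; exact: c.
- by move=> s /andP[s0 _]; have ds := d _ s0; apply: is_derive_eq; rewrite oppr0.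
by move=> s _; rewrite mul0r.
Qed.

(** A zero mean gives [L * g x = int (g x - g y) dy], so [|g|] is bounded by the total variation
    [A], and [A^2 <= L * sqint p] by Cauchy-Schwarz. *)
Lemma poincare (g p : R -> R) : continuous p ->
  (forall x, 0 <= x <= L -> g x = g 0 + int_ab 0 x p) -> continuous g ->
  int_ab 0 L g = 0 -> sqint g <= L ^+ 2 * sqint p.
Proof.
move=> cp gp cg g0.
set A := int_ab 0 L (fun x => `|p x|).
have osc x y : 0 <= x <= y -> y <= L -> `|g y - g x| <= A.
  move=> /andP[x0 xy] yL.
  rewrite (gp y) ?(le_trans x0)//= ?yL// (gp x) ?x0 ?(le_trans xy)//.
  rewrite (int_split cp x0 xy) [X in `|X|](_ : _ = int_ab x y p); last by ring.
  apply: le_trans (le_norm_int _ _ cp) _.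
  by apply: int_mono => //; exact: cont_norm.
have oscx x y : 0 <= x <= L -> 0 <= y <= L -> `|g y - g x| <= A.
  move=> /andP[x0 xL] /andP[y0 yL]; case: (leP x y) => [xy|/ltW yx].
    by apply: osc; rewrite ?x0.
  by rewrite distrC; apply: osc; rewrite ?y0.
have A0 : 0 <= A by apply: int_ge0.
have gA x : 0 <= x <= L -> g x ^+ 2 <= A ^+ 2.
  move=> xL.
  have h : L * g x = int_ab 0 L (fun y => g x - g y).
    by rewrite intB// ?g0 ?int_cst ?(ltW L0)//; [ring|move=> ?; exact: cvg_cst].
  have cc : continuous (fun y => g x - g y).
    by apply: cont_sub => // ?; exact: cvg_cst.
  have : `|L * g x| <= L * A.
    rewrite h; apply: le_trans (le_norm_int _ _ cc) _.
    have -> : L * A = int_ab 0 L (fun=> A) by rewrite int_cst ?(ltW L0)//; ring.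
    apply: le_int; [exact: cont_norm|move=> ?; exact: cvg_cst|].
    by move=> y yL; exact: oscx.
  rewrite normrM (gtr0_norm L0) ler_pM2l// => gxA.
  by rewrite -(real_normK (num_real (g x))) lerXn2r ?nnegrE.
have -> : L ^+ 2 * sqint p = L * (L * sqint p) by ring.
apply: (@le_trans _ _ (L * A ^+ 2)).
  have -> : L * A ^+ 2 = int_ab 0 L (fun=> A ^+ 2) by rewrite int_cst ?(ltW L0)//; ring.
  by apply: le_int => //; [exact: cont_sqr|move=> ?; exact: cvg_cst].
rewrite ler_pM2l//.
by have := int_CS cp (ltW L0); rewrite subr0.
Qed.

(** Without source the energy has derivative [- 2 |z_x|^2], which Poincare's inequality bounds by
    [- (2 / L^2) |z|^2] as long as the mean vanishes. *)
Lemma heat_decay z zx zxx zt F : neumann_heat 0 0 z zx zxx zt F ->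
  (forall t x : R, 0 < t -> 0 < x < L -> F t x = 0) -> int_ab 0 L (z 0) = 0 ->
  forall t : R, 0 <= t -> sqint (z t) <= expR (- (2 / L ^+ 2) * t) * sqint (z 0).
Proof.
move=> H F0 z0 t t0.
have ztE (s : R) : 0 < s -> forall x, 0 < x < L -> zt s x = zxx s x.
  by move=> s0 x xL; apply/eqP; rewrite -subr_eq0 (nh_eq H)// F0.
(* The mean is conserved: the integral of [z_xx] is the difference of the two zero Neumann
   values. *)
have m : forall s : R, 0 < s -> int_ab 0 L (zt s) = 0.
  move=> s s0; rewrite (@eq_int_oo _ _ (zxx s)) ?(ltW L0)//.
  - have := nh_xx H (x := L) s0; rewrite (nh_b1 H)// lexx ltW// add0r => <-//.
  - exact: (nh_czt H).
  - exact: (nh_cxx H).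
  - exact: ztE.
apply: (@gronwall _ (fun s : R => sqint (z s)) _ _ _ t0 (sqint_cont H)).
  by move=> s /andP[s0 _]; exact: (sqint_derive H).
move=> s /andP[s0 _] /=.
have cz := nh_cz H (ltW s0); have czt := nh_czt H s0; have cxx := nh_cxx H s0.
rewrite (@eq_int_oo _ _ (fun x => 2 * (z s x * zxx s x))) ?(ltW L0)//; last first.
- by move=> x xL; rewrite ztE.
- by apply: cont_scale; exact: cont_mul.
- by apply: cont_scale; exact: cont_mul.
rewrite intZ; last exact: cont_mul.
rewrite (int_z_zxx H)// mulrN mulNr lerN2 -mulrA ler_pM2l//.
rewrite mulrC ler_pdivrMr ?exprn_gt0// mulrC.
apply: poincare => //; [exact: (nh_cx H)|by move=> x; exact: (nh_x H)|].
by rewrite (heat_mean H m (ltW s0)).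
Qed.

End Heat.

(** * Square integrals and their pointwise limits *)

Section SquareIntegral.
Variables (R : realType) (L : R).
Implicit Types (f g h : R -> R).
Notation mu := (@lebesgue_measure R).

Lemma sqintZ k f : continuous f -> sqint L (fun x => k * f x) = k ^+ 2 * sqint L f.
Proof.
move=> cf; rewrite /sqint -intZ; last exact: cont_sqr.
by apply: eq_int => x _; rewrite exprMn.
Qed.

Lemma sqint_le2 f g h : continuous f -> continuous g -> continuous h ->
  (forall x, 0 <= x <= L -> h x = f x + g x) ->
  sqint L h <= 2 * (sqint L f + sqint L g).
Proof.
move=> cf cg ch hE; rewrite /sqint -intD; [|exact: cont_sqr..].
rewrite -intZ; last by apply: cont_add; exact: cont_sqr.
apply: le_int; first exact: cont_sqr.
  by apply: cont_scale; apply: cont_add; exact: cont_sqr.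
by move=> x xL; rewrite hE//; have := sqr_ge0 (f x - g x); nra.
Qed.

Lemma eq_sqint f g : (forall x, 0 <= x <= L -> f x = g x) -> sqint L f = sqint L g.
Proof. by move=> fg; apply: eq_int => x xL; rewrite fg. Qed.

(** Fatou's lemma asks for no domination, which is not at hand for difference quotients in time. The
    bound [M n] may vary with [n] because the estimates for quotients carry an extra term that
    vanishes only in the limit. *)
Lemma sqint_fatou (g : nat -> R -> R) (gl : R -> R) (M : nat -> R) (Ml : R) :
  (forall n, continuous (g n)) -> continuous gl ->
  (forall x : R, 0 <= x <= L -> g n x @[n --> \oo] --> gl x) ->
  (forall n, sqint L (g n) <= M n) -> M n @[n --> \oo] --> Ml ->
  sqint L gl <= Ml.
Proof.
move=> cg cgl gcvg gM Mcvg.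
have EI (f : R -> R) : continuous f -> (\int[mu]_(x in `[0%R, L]) (f x ^+ 2)%:E = (sqint L f)%:E)%E.
  move=> cf; rewrite /sqint /int_ab /Rintegral fineK//.
  apply: integrable_fin_num => //; apply: integrable_cont; exact: cont_sqr.
have F := @fatou _ _ _ mu `[0, L]%classic (measurable_itv _) (fun n x => (g n x ^+ 2)%:E).
rewrite -lee_fin -EI//.
apply: (@le_trans _ _ (limn_einf (fun n => \int[mu]_(x in `[0%R, L]) (g n x ^+ 2)%:E)%E)).
  rewrite (_ : (\int[mu]_(x in `[0%R, L]) (gl x ^+ 2)%:E =
    \int[mu]_(x in `[0%R, L]) limn_einf (fun n => (g n x ^+ 2)%:E))%E).
    apply: F.
    - move=> n; apply/measurable_EFinP.
      apply: measurable_funTS; apply: continuous_measurable_fun; exact: cont_sqr.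
    - by move=> n x _; rewrite lee_fin sqr_ge0.
  apply: eq_integral => x; rewrite inE/= in_itv/= => xL.
  have gx2 : (g n x ^+ 2)%:E @[n --> \oo] --> (gl x ^+ 2)%:E.
    apply: cvg_EFin; first exact: nearW.
    exact: (cvgM (gcvg x xL) (gcvg x xL)).
  by rewrite (cvg_limn_einf_sup gx2).
have Mc : (M n)%:E @[n --> \oo] --> Ml%:E by apply: cvg_EFin => //; exact: nearW.
rewrite -(cvg_lim _ Mc)// limn_einf_lim; apply: lee_lim.
- exact: is_cvg_einfs.
- by apply/cvg_ex; exists Ml%:E.
apply: nearW => n; apply: (@le_trans _ _ (sqint L (g n))%:E); last by rewrite lee_fin.
by rewrite -EI//; apply: ereal_inf_lbound; exists n => /=.
Qed.

End SquareIntegral.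

(** * Bounds on the time increments of the solution, down to the initial time *)

Section TimeRegularity.
Variables (R : realType) (L : R).
Hypothesis L0 : 0 < L.

(** Hiding the derivatives leaves a property of [z] alone, stable under linear combinations and time
    translations. *)
Definition homogeneous_heat (z : R -> R -> R) := exists zx zxx zt F,
  neumann_heat L 0 0 z zx zxx zt F /\ (forall t x : R, 0 < t -> 0 < x < L -> F t x = 0).

Lemma homogeneous_heat_lin k k' z z' : homogeneous_heat z -> homogeneous_heat z' ->
  homogeneous_heat (fun t x => k * z t x + k' * z' t x).
Proof.
move=> [zx [zxx [zt [F [H F0]]]]] [zx' [zxx' [zt' [F' [H' F0']]]]].
have := neumann_heat_lin k k' H H'; rewrite !mulr0 addr0 => HH.
do 4 eexists; split; first exact: HH.
by move=> t x t0 xL /=; rewrite F0// F0'// !mulr0 addr0.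
Qed.

Lemma homogeneous_heat_shift z s : 0 <= s -> homogeneous_heat z ->
  homogeneous_heat (fun t => z (t + s)).
Proof.
move=> s0 [zx [zxx [zt [F [H F0]]]]].
do 4 eexists; split; first exact: (neumann_heat_shift s0 H).
by move=> t x t0 xL /=; rewrite F0// ltr_wpDr.
Qed.

Definition decay (t : R) := expR (- (2 / L ^+ 2) * t).

Lemma decay_le1 t : 0 <= t -> decay t <= 1.
Proof.
move=> t0; rewrite -expR0 ler_expR mulNr oppr_le0 mulr_ge0//.
by rewrite divr_ge0// exprn_ge0// ltW.
Qed.

Lemma decay_ge0 t : 0 <= decay t.
Proof. exact: expR_ge0. Qed.

Lemma homogeneous_heat_decay z : homogeneous_heat z -> int_ab 0 L (z 0) = 0 ->
  forall t : R, 0 <= t -> sqint L (z t) <= decay t * sqint L (z 0).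
Proof. by move=> [zx [zxx [zt [F [H F0]]]]]; exact: (heat_decay L0 H). Qed.

Variables (beta gamma : R) (U UX UXX UT : R -> R -> R) (fc phi psi : R -> R).
Variables (WX WXX WT : R -> R -> R).
(** Remainder of the first-order expansion at time 0, with [phi] in the place of the time derivative
    there. *)
Let W (t x : R) := U t x - U 0 x - t * phi x.
Hypothesis HU : neumann_heat L beta gamma U UX UXX UT (fun _ => fc).
Hypothesis HW : neumann_heat L 0 0 W WX WXX WT (fun t x => t * psi x).
Hypotheses (cphi : continuous phi) (cpsi : continuous psi).
Hypothesis mass : forall t : R, 0 < t -> int_ab 0 L (UT t) = 0.

Let D (k t x : R) := U (t + k) x - U t x.

Let cU (t : R) : 0 <= t -> continuous (U t).
Proof. by move=> t0; exact: (nh_cz HU). Qed.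

Let cW (t : R) : 0 <= t -> continuous (W t).
Proof. by move=> t0; exact: (nh_cz HW). Qed.

Let cD (k t : R) : 0 <= k -> 0 <= t -> continuous (D k t).
Proof. by move=> k0 t0; apply: cont_sub; apply: cU => //; rewrite addr_ge0. Qed.

(** The source and the Neumann data do not depend on time, so a time increment loses both. *)
Let homogeneous_heat_D (k : R) : 0 <= k -> homogeneous_heat (D k).
Proof.
move=> k0; have := neumann_heat_lin 1 (-1) (neumann_heat_shift k0 HU) HU.
rewrite !mul1r !mulN1r !subrr => H.
have -> : D k = fun t x => 1 * U (t + k) x + (-1) * U t x.
  by apply/funext => t; apply/funext => x; rewrite /D mul1r mulN1r.
do 4 eexists; split; first exact: H.
by move=> t x _ _ /=; rewrite mul1r mulN1r subrr.
Qed.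

Let mean_D (k t : R) : 0 <= k -> 0 <= t -> int_ab 0 L (D k t) = 0.
Proof.
move=> k0 t0; have tk0 : 0 <= t + k by rewrite addr_ge0.
rewrite intB; [|exact: cU..].
by rewrite (heat_mean HU mass tk0) (heat_mean HU mass t0) subrr.
Qed.

Let Psi := sqint L psi.
Let e := expR 1 : R.

Let e_ge0 : 0 <= e. Proof. exact: expR_ge0. Qed.

Let Psi_ge0 : 0 <= Psi. Proof. exact: sqint_ge0. Qed.

Let sqint_W0 : sqint L (W 0) = 0.
Proof.
rewrite (@eq_sqint _ _ _ (fun=> 0)); last by move=> x _; rewrite /W; ring.
by rewrite /sqint expr0n/= int_cst ?(ltW L0)// mul0r.
Qed.

(** [heat_energy] with [tau] and [sigma] both equal to [t]: up to time [t] the source [s psi] is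
    dominated by [t psi], and [W] starts from 0. Hence the fourth power. *)
Let sqint_W (t : R) : 0 < t -> sqint L (W t) <= e * t ^+ 4 * Psi.
Proof.
move=> t0; have := heat_energy L0 (sigma := t) HW cpsi t0.
rewrite sqint_W0 add0r -exprD -!mulrA; apply => s x /andP[s0 st] _.
rewrite exprMn ler_wpM2r ?sqr_ge0//.
by rewrite lerXn2r ?nnegrE ?ltW// (lt_trans s0).
Qed.

(* [W (t + k) - W t] solves the heat equation with source [k psi] and starts at [W k]. *)
Let sqint_DW (h k : R) : 0 < h -> 0 < k ->
  sqint L (fun x => W (h + k) x - W h x) <= e * (e * k ^+ 4 + h ^+ 2 * k ^+ 2) * Psi.
Proof.
move=> h0 k0; have := neumann_heat_lin 1 (-1) (neumann_heat_shift (ltW k0) HW) HW.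
rewrite !mulr0 addr0 => H.
have := heat_energy L0 (sigma := k) H cpsi h0.
rewrite add0r.
have -> : sqint L (fun x => 1 * W (h + k) x + (-1) * W h x) =
    sqint L (fun x => W (h + k) x - W h x).
  by apply: eq_sqint => x _; rewrite mul1r mulN1r.
have -> : sqint L (fun x => 1 * W k x + (-1) * W 0 x) = sqint L (W k).
  by apply: eq_sqint => x _; rewrite /W; ring.
move=> bnd; apply: (le_trans (bnd _)).
  move=> t x _ _ /=; rewrite le_eqVlt; apply/orP; left; apply/eqP; ring.
have := sqint_W k0; rewrite -/Psi -/e => sW.
rewrite -[leRHS]mulrA ler_pM2l ?expR_gt0// [leRHS]mulrDl.
by rewrite lerD.
Qed.

Let sqint_D0 (k : R) : 0 < k ->
  sqint L (D k 0) <= 2 * (k ^+ 2 * sqint L phi + e * k ^+ 4 * Psi).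
Proof.
move=> k0.
have ck : continuous (fun x => k * phi x) by exact: cont_scale.
apply: le_trans (sqint_le2 ck (cW (ltW k0)) (cD (ltW k0) (lexx 0)) _) _.
  by move=> x _; rewrite /D /W add0r; ring.
by rewrite sqintZ// ler_pM2l// lerD2l; exact: sqint_W.
Qed.

Let sqint_D (t k : R) : 0 <= t -> 0 < k ->
  sqint L (D k t) <= 2 * (k ^+ 2 * sqint L phi + e * k ^+ 4 * Psi).
Proof.
move=> t0 k0; apply: le_trans (sqint_D0 k0).
apply: le_trans (homogeneous_heat_decay (homogeneous_heat_D (ltW k0))
  (mean_D (ltW k0) (lexx 0)) t0) _.
by rewrite ler_piMl ?sqint_ge0// decay_le1.
Qed.

(** The second difference is again a homogeneous solution of zero mean, so it decays from its value
    at time 0. There the terms linear in time cancel, leaving [(W (h + k) - W h) - W k]. *)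
Let sqint_DD (t h k : R) : 0 <= t -> 0 < h -> 0 < k ->
  sqint L (fun x => D k (t + h) x - D k t x) <=
    decay t * (2 * (e * (e * k ^+ 4 + h ^+ 2 * k ^+ 2) * Psi + e * k ^+ 4 * Psi)).
Proof.
move=> t0 h0 k0.
have E s : (fun x => 1 * D k (s + h) x + (-1) * D k s x) = (fun x => D k (s + h) x - D k s x).
  by apply/funext => x; rewrite mul1r mulN1r.
have H := homogeneous_heat_lin 1 (-1)
  (homogeneous_heat_shift (ltW h0) (homogeneous_heat_D (ltW k0))) (homogeneous_heat_D (ltW k0)).
have := homogeneous_heat_decay H; rewrite E => /(_ _ _ t0); rewrite E => bnd.
have hk := ltW h0; have kk := ltW k0; have hkk : 0 <= 0 + h by rewrite add0r.
apply: le_trans (bnd _) _.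
  by rewrite intB; [rewrite !mean_D// subrr|exact: cD..].
rewrite ler_wpM2l ?decay_ge0//.
have c1 : continuous (fun x => W (h + k) x - W h x).
  by apply: cont_sub; apply: cW => //; rewrite addr_ge0.
have c2 : continuous (fun x => (-1) * W k x) by apply: cont_scale; exact: cW.
apply: le_trans (sqint_le2 c1 c2 _ _) _.
- by apply: cont_sub; exact: cD.
- by move=> x _; rewrite /D /W !add0r; ring.
rewrite ler_pM2l// sqintZ ?sqrrN ?expr1n ?mul1r; last exact: cW.
by rewrite lerD// ?sqint_DW// sqint_W.
Qed.

(** The coefficient [h / k] makes the [phi] terms cancel at time 0, where the combination equals
    [W h - h / k * W k]. As [k] tends to 0 it becomes the first-order Taylor remainder of [U] at
    [t]. *)
Let sqint_R (t h k : R) : 0 <= t -> 0 < h -> 0 < k ->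
  sqint L (fun x => D h t x - h / k * D k t x) <=
    decay t * (2 * (e * h ^+ 4 * Psi + (h / k) ^+ 2 * (e * k ^+ 4 * Psi))).
Proof.
move=> t0 h0 k0.
have E s : (fun x => 1 * D h s x + (- (h / k)) * D k s x) = (fun x => D h s x - h / k * D k s x).
  by apply/funext => x; rewrite mul1r mulNr.
have hk := ltW h0; have kk := ltW k0.
have H := homogeneous_heat_lin 1 (- (h / k)) (homogeneous_heat_D hk) (homogeneous_heat_D kk).
have := homogeneous_heat_decay H; rewrite E => /(_ _ _ t0); rewrite E => bnd.
apply: le_trans (bnd _) _.
  rewrite intB; [|exact: cD|by apply: cont_scale; exact: cD].
  by rewrite intZ; [rewrite !mean_D// mulr0 subrr|exact: cD].
rewrite ler_wpM2l ?decay_ge0//.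
have c2 : continuous (fun x => - (h / k) * W k x) by apply: cont_scale; exact: cW.
apply: le_trans (sqint_le2 (cW hk) c2 _ _) _.
- by apply: cont_sub; [exact: cD|apply: cont_scale; exact: cD].
- by move=> x _; rewrite /D /W !add0r; field; rewrite gt_eqF.
rewrite ler_pM2l// sqintZ ?sqrrN; last exact: cW.
by rewrite lerD ?sqint_W// ler_wpM2l ?sqr_ge0// sqint_W.
Qed.

Let step (n : nat) : R := n.+1%:R^-1.

Let step_gt0 n : 0 < step n.
Proof. by rewrite invr_gt0. Qed.

Let cvg_step : step n @[n --> \oo] --> (0 : R).
Proof. exact: cvg_harmonic. Qed.

Let cvg_quot (t x : R) : 0 < t ->
  (step n)^-1 * D (step n) t x @[n --> \oo] --> UT t x.
Proof.
move=> t0; have [dU UTE] := nh_t HU x t0.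
have cl : h^-1 *: (U (h *: 1 + t) x - U t x) @[h --> 0^'] --> UT t x.
  by rewrite -UTE; exact: dU.
have hs : (forall n, step n != 0) /\ step n @[n --> \oo] --> (0 : R).
  by split; [move=> n; rewrite gt_eqF|exact: cvg_step].
have := (cvgr_dnbhsP (fun h : R => h^-1 *: (U (h *: 1 + t) x - U t x)) 0 (UT t x)).1 cl step hs.
have -> // : (fun n => (step n)^-1 *: (U (step n *: 1 + t) x - U t x)) =
    (fun n => (step n)^-1 * D (step n) t x).
by apply/funext => n; rewrite /D /GRing.scale/= mulr1 [step n + t]addrC.
Qed.

(* [u_t], extended to [t = 0] by its expected value [phi] *)
Definition ut_ext (t : R) : R -> R := if 0 < t then UT t else phi.

Let cvg_poly2 (a b : R) : a + b * step n ^+ 2 @[n --> \oo] --> a.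
Proof.
rewrite -[X in _ --> X]addr0; apply: cvgD; first exact: cvg_cst.
rewrite -[X in _ --> X](mulr0 b); apply: cvgM; first exact: cvg_cst.
by rewrite -[X in _ --> X](mulr0 0); apply: cvgM; exact: cvg_step.
Qed.

Lemma ut_ext_cont (t : R) : continuous (ut_ext t).
Proof. by rewrite /ut_ext; case: ifPn => // t0; exact: (nh_czt HU). Qed.

(** Limit of [sqint_D] divided by [k^2]: the contribution of [psi] is then of order [k^2] and
    disappears. *)
Lemma sqint_ut_ext (t : R) : sqint L (ut_ext t) <= 2 * sqint L phi.
Proof.
rewrite /ut_ext; case: ifPn => [t0|_]; last by have := sqint_ge0 L phi; lra.
apply: (@sqint_fatou _ _ (fun n x => (step n)^-1 * D (step n) t x) _
  (fun n => 2 * sqint L phi + (2 * e * Psi) * step n ^+ 2)).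
- by move=> n; apply: cont_scale; apply: cD; exact: ltW.
- exact: (nh_czt HU).
- by move=> x _; exact: cvg_quot.
- move=> n; have s0 := step_gt0 n.
  rewrite sqintZ; last by apply: cD; exact: ltW.
  have := sqint_D (ltW t0) s0.
  rewrite -(@ler_pM2l _ ((step n)^-1 ^+ 2)); last by rewrite exprn_gt0// invr_gt0.
  move=> h; apply: (le_trans h); rewrite le_eqVlt; apply/orP; left; apply/eqP.
  by field; rewrite gt_eqF.
- exact: cvg_poly2.
Qed.

Lemma sqint_ut_ext_diff (t h : R) : 0 <= t -> 0 < h ->
  sqint L (fun x => ut_ext (t + h) x - ut_ext t x) <= decay t * (2 * e * h ^+ 2 * Psi).
Proof.
rewrite le_eqVlt => /predU1P[<-|t0] h0.
  (* At time 0 [ut_ext] is [phi] by definition and not as a limit of quotients. The difference is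
     instead seen as the time derivative of [W] at time [h], to which [sqint_DW] applies. *)
  rewrite add0r /ut_ext h0 ltxx /decay mulr0 expR0 mul1r.
  apply: (@le_trans _ _ (e * h ^+ 2 * Psi)); last first.
    have : 0 <= e * h ^+ 2 * Psi.
      by apply: mulr_ge0 => //; apply: mulr_ge0 => //; exact: sqr_ge0.
    lra.
  apply: (@sqint_fatou _ _ (fun n x => (step n)^-1 * (W (h + step n) x - W h x)) _
    (fun n => e * h ^+ 2 * Psi + (e * e * Psi) * step n ^+ 2)).
  - move=> n; apply: cont_scale; apply: cont_sub; apply: cW; rewrite ?ltW//.
    by rewrite addr_gt0.
  - by apply: cont_sub => //; exact: (nh_czt HU).
  - move=> x _.
    have -> : (fun n => (step n)^-1 * (W (h + step n) x - W h x)) =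
        (fun n => (step n)^-1 * D (step n) h x - phi x).
      by apply/funext => n; rewrite /D /W; field; rewrite gt_eqF.
    by apply: cvgB; [exact: cvg_quot|exact: cvg_cst].
  - move=> n; have s0 := step_gt0 n; rewrite sqintZ; last first.
      by apply: cont_sub; apply: cW; rewrite ?ltW// addr_gt0.
    have := sqint_DW h0 s0.
    rewrite -(@ler_pM2l _ ((step n)^-1 ^+ 2)); last by rewrite exprn_gt0// invr_gt0.
    move=> hh; apply: (le_trans hh); rewrite le_eqVlt; apply/orP; left; apply/eqP.
    by field; rewrite gt_eqF.
  - exact: cvg_poly2.
(* For positive [t] both terms are limits of quotients. Of the bound in [sqint_DD] only the term in
   [h^2 k^2] survives the division by [k^2]. *)
have th0 : 0 < t + h by rewrite addr_gt0.
rewrite /ut_ext t0 th0.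
apply: (@sqint_fatou _ _ (fun n x => (step n)^-1 * (D (step n) (t + h) x - D (step n) t x)) _
  (fun n => decay t * (2 * e * h ^+ 2 * Psi) + (decay t * (2 * e * (e + 1) * Psi)) * step n ^+ 2)).
- by move=> n; apply: cont_scale; apply: cont_sub; apply: cD; exact: ltW.
- by apply: cont_sub; exact: (nh_czt HU).
- move=> x _.
  have -> : (fun n => (step n)^-1 * (D (step n) (t + h) x - D (step n) t x)) =
      (fun n => (step n)^-1 * D (step n) (t + h) x - (step n)^-1 * D (step n) t x).
    by apply/funext => n; rewrite mulrBr.
  by apply: cvgB; exact: cvg_quot.
- move=> n; have s0 := step_gt0 n; rewrite sqintZ; last first.
    by apply: cont_sub; apply: cD; exact: ltW.
  have := sqint_DD (ltW t0) h0 s0.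
  rewrite -(@ler_pM2l _ ((step n)^-1 ^+ 2)); last by rewrite exprn_gt0// invr_gt0.
  move=> hh; apply: (le_trans hh); rewrite le_eqVlt; apply/orP; left; apply/eqP.
  by field; rewrite gt_eqF.
- exact: cvg_poly2.
Qed.

(** At time 0 the remainder is [W h] itself; at positive times it is the limit of the combinations
    in [sqint_R]. *)
Lemma sqint_ut_ext_taylor (t h : R) : 0 <= t -> 0 < h ->
  sqint L (fun x => U (t + h) x - U t x - h * ut_ext t x) <= decay t * (2 * e * h ^+ 4 * Psi).
Proof.
rewrite le_eqVlt => /predU1P[<-|t0] h0.
  rewrite add0r /ut_ext ltxx /decay mulr0 expR0 mul1r.
  have := sqint_W h0; rewrite /W => hW; apply: (le_trans hW).
  have : 0 <= e * h ^+ 4 * Psi.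
    by apply: mulr_ge0 => //; apply: mulr_ge0 => //; apply: exprn_ge0; exact: ltW.
  lra.
rewrite /ut_ext t0.
apply: (@sqint_fatou _ _ (fun n x => D h t x - h / step n * D (step n) t x) _
  (fun n => decay t * (2 * e * h ^+ 4 * Psi) + (decay t * (2 * e * h ^+ 2 * Psi)) * step n ^+ 2)).
- move=> n; apply: cont_sub; first by apply: cD; exact: ltW.
  by apply: cont_scale; apply: cD; exact: ltW.
- apply: cont_sub; first by apply: cD; exact: ltW.
  by apply: cont_scale; exact: (nh_czt HU).
- move=> x _; apply: cvgB; first exact: cvg_cst.
  have -> : (fun n => h / step n * D (step n) t x) = (fun n => h * ((step n)^-1 * D (step n) t x)).
    by apply/funext => n; rewrite mulrA.
  by apply: cvgM; [exact: cvg_cst|exact: cvg_quot].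
- move=> n; have s0 := step_gt0 n.
  have := sqint_R (ltW t0) h0 s0.
  move=> hh; apply: (le_trans hh); rewrite le_eqVlt; apply/orP; left; apply/eqP.
  by field; rewrite gt_eqF.
- exact: cvg_poly2.
Qed.

End TimeRegularity.

(** * The discrete norm and the stability of the explicit scheme *)

Section Discrete.
Variable R : realType.
Implicit Types (J : nat) (L : R) (w : nat -> R).

Lemma l2norm_ge0 J (v : 'cV[R]_J) : 0 <= l2norm v.
Proof. exact: sqrtr_ge0. Qed.

Lemma l2norm_le J (v : 'cV[R]_J) (A : R) : 0 <= A ->
  (l2norm v <= A) = (J%:R^-1 * \sum_(j < J) v j 0 ^+ 2 <= A ^+ 2).
Proof.
move=> A0; rewrite /l2norm -{1}(ger0_norm A0) -sqrtr_sqr ler_sqrt//.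
exact: sqr_ge0.
Qed.

Lemma l2norm_sqr J (v : 'cV[R]_J) :
  l2norm v ^+ 2 = J%:R^-1 * \sum_(j < J) v j 0 ^+ 2.
Proof.
by rewrite sqr_sqrtr// mulr_ge0 ?invr_ge0 ?ler0n// sumr_ge0// => j _; exact: sqr_ge0.
Qed.

Lemma l2norm_sup J (v : 'cV[R]_J) (M : R) : 0 <= M ->
  (forall j, `|v j 0| <= M) -> l2norm v <= M.
Proof.
move=> M0 vM; rewrite l2norm_le//.
case: J v vM => [|m] v vM; first by rewrite big_ord0 mulr0 sqr_ge0.
rewrite ler_pdivrMl ?ltr0Sn//.
apply: (@le_trans _ _ (\sum_(j < m.+1) M ^+ 2)).
  apply: ler_sum => j _; rewrite -(real_normK (num_real (v j 0))).
  by rewrite lerXn2r ?nnegrE.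
by rewrite sumr_const card_ord mulr_natl.
Qed.

(* Minkowski: [(a + b)^2 <= (A + B) (a^2 / A + b^2 / B)] for positive [A], [B]. *)
Lemma l2norm_triangle J (v w : 'cV[R]_J) : l2norm (v + w) <= l2norm v + l2norm w.
Proof.
apply/ler_addgt0Pr => eps eps0.
(* The slack [eps] keeps [A] and [B] positive even if one of the norms vanishes. *)
set A := l2norm v + eps / 2; set B := l2norm w + eps / 2.
have v0 := l2norm_ge0 v; have w0 := l2norm_ge0 w.
have A0 : 0 < A by rewrite ltr_wpDl// divr_gt0.
have B0 : 0 < B by rewrite ltr_wpDl// divr_gt0.
have -> : l2norm v + l2norm w + eps = A + B by rewrite /A /B; field.
rewrite l2norm_le; last by rewrite addr_ge0// ltW.
apply: (@le_trans _ _ ((A + B) * (l2norm v ^+ 2 / A + l2norm w ^+ 2 / B))).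
  rewrite !l2norm_sqr.
  have -> : (A + B) * (J%:R^-1 * (\sum_(j < J) v j 0 ^+ 2) / A
      + J%:R^-1 * (\sum_(j < J) w j 0 ^+ 2) / B) =
    J%:R^-1 * \sum_(j < J) ((A + B) * (v j 0 ^+ 2 / A + w j 0 ^+ 2 / B)).
    rewrite -mulr_sumr big_split/= -!mulr_suml; ring.
  rewrite ler_wpM2l ?invr_ge0 ?ler0n//; apply: ler_sum => j _; rewrite mxE.
  rewrite -subr_ge0.
  have -> : (A + B) * (v j 0 ^+ 2 / A + w j 0 ^+ 2 / B) - (v j 0 + w j 0) ^+ 2 =
      (B * v j 0 - A * w j 0) ^+ 2 / (A * B).
    by field; rewrite !gt_eqF.
  by rewrite divr_ge0 ?sqr_ge0// ltW// mulr_gt0.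
have sqdiv (a X : R) : 0 <= a -> 0 < X -> a <= X -> a ^+ 2 / X <= X.
  move=> a0 X0 aX; rewrite ler_pdivrMr// -expr2 lerXn2r// nnegrE; lra.
rewrite [leRHS]expr2 ler_pM2l; last exact: addr_gt0.
by apply: lerD; apply: sqdiv => //; rewrite lerDl ltW// divr_gt0.
Qed.

Lemma l2normN J (v : 'cV[R]_J) : l2norm (- v) = l2norm v.
Proof.
by congr (Num.sqrt (_ * _)); apply: eq_bigr => j _; rewrite mxE sqrrN.
Qed.

(** The rows of [dx^2 P] in flux form: the difference of a right and a left flux, where the flux
    through either end of the grid is 0. This accounts for the diagonal entries -1. *)
Definition lap J w (j : nat) : R :=
  (if (j.+1 < J)%N then w j.+1 - w j else 0) - (if (0 < j)%N then w j - w j.-1 else 0).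

Lemma sum_delta J w (k : nat) :
  \sum_(j < J) (if (j : nat) == k then w j else 0) = if (k < J)%N then w k else 0.
Proof.
rewrite -big_mkcond/=; case: ifPn => [kJ|].
  by rewrite (big_pred1 (Ordinal kJ)).
rewrite -leqNgt => Jk; apply: big_pred0 => j.
by apply/negbTE; rewrite neq_ltn (leq_trans (ltn_ord j)).
Qed.

Lemma Pmat_mul J L w (i : 'I_J) : (2 <= J)%N ->
  (Pmat J L *m (\col_(j < J) w j)) i 0 = (dx J L ^+ 2)^-1 * lap J w i.
Proof.
move=> J2; rewrite mxE.
(* Each row is a sum of three point masses. The guard [0 < i] is needed because [0.-1 = 0] would
   otherwise create a left neighbour of the first node. *)
have -> : \sum_j Pmat J L i j * (\col_(j0 < J) w j0) j 0 =
   (dx J L ^+ 2)^-1 * \sum_(j < J) ((if (j : nat) == i.+1 then w j else 0) +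
      ((if (j : nat) == i.-1 then (if (0 < i)%N then w j else 0) else 0) -
       (if (j : nat) == i then
         ((if (i.+1 < J)%N then 1 else 0) + (if (0 < i)%N then 1 else 0)) * w j else 0))).
  rewrite mulr_sumr; apply: eq_bigr => j _; rewrite !mxE -mulrA; congr (_ * _).
  rewrite -(inj_eq val_inj) /= eq_sym.
  have := ltn_ord i; have := ltn_ord j.
  case: eqVneq => [->|ji] jJ iJ.
    rewrite [(i : nat) == i.+1]ltn_eqF//.
    case: (posnP i) => [->|i0].
      by rewrite /= J2; ring.
    rewrite [(i : nat) == i.-1]gtn_eqF ?prednK//=.
    case: eqVneq => [iJ1|iJ1].
      by rewrite [(i.+1 < J)%N](_ : _ = false); [ring|lia].
    by rewrite [(i.+1 < J)%N](_ : _ = true); [ring|lia].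
  case: (eqVneq (j : nat) i.+1) => [ji1|ji1].
    rewrite [(j : nat) == i.-1](_ : _ = false); last by lia.
    by rewrite orbT; ring.
  case: (eqVneq (i : nat) j.+1) => [ij|ij].
    rewrite [(j : nat) == i.-1](_ : _ = true); last by lia.
    by rewrite [(0 < i)%N](_ : _ = true); [rewrite /=; ring|lia].
  by case: (eqVneq (j : nat) i.-1) => [ji2|_]; [exfalso; lia|rewrite /=; ring].
congr (_ * _); rewrite big_split/= sumrB.
rewrite (sum_delta _ w) (sum_delta _ (fun j => if (0 < i)%N then w j else 0)).
rewrite (sum_delta _
  (fun j => ((if (i.+1 < J)%N then 1 else 0) + (if (0 < i)%N then 1 else 0)) * w j)).
rewrite ltn_ord /lap [(i.-1 < J)%N](_ : _ = true); last by have := ltn_ord i; lia.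
by case: ifP => _; case: ifP => _; ring.
Qed.

(** With ghost values repeating the end values, the new value is the combination of [w j], [wr j],
    [wl j] with weights [1 - 2 lam], [lam], [lam], convex under the CFL condition, so its square is
    at most the combination of the squares. The sum of [wr^2] misses the first square and doubles
    the last, that of [wl^2] does the opposite; together they give twice the sum of [w^2]. *)
Lemma lap_contract (m : nat) w (lam : R) : 0 <= lam -> lam <= 1 / 2 ->
  \sum_(j < m.+1) (w j + lam * lap m.+1 w j) ^+ 2 <= \sum_(j < m.+1) w j ^+ 2.
Proof.
move=> l0 l1.
pose wr j := if (j.+1 < m.+1)%N then w j.+1 else w j.
pose wl j := if (0 < j)%N then w j.-1 else w j.
have lapE j : lap m.+1 w j = (wr j - w j) - (w j - wl j).
  by rewrite /lap /wr /wl; case: ifP => _; case: ifP => _; ring.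
apply: (@le_trans _ _ (\sum_(j < m.+1)
    ((1 - 2 * lam) * w j ^+ 2 + lam * (wr j ^+ 2 + wl j ^+ 2)))).
  apply: ler_sum => j _; rewrite lapE -subr_ge0.
  set a := w j; set b := wr j; set c := wl j.
  have -> : (1 - 2 * lam) * a ^+ 2 + lam * (b ^+ 2 + c ^+ 2)
      - (a + lam * (b - a - (a - c))) ^+ 2 =
    (1 - 2 * lam) * lam * ((a - b) ^+ 2 + (a - c) ^+ 2) + lam ^+ 2 * (b - c) ^+ 2.
    by ring.
  have l2 : 0 <= 1 - 2 * lam by lra.
  apply: addr_ge0; last by rewrite mulr_ge0 ?sqr_ge0.
  by apply: mulr_ge0; [exact: mulr_ge0|rewrite addr_ge0 ?sqr_ge0].
rewrite big_split/= -!mulr_sumr big_split/=.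
suff -> : \sum_(j < m.+1) wr j ^+ 2 + \sum_(j < m.+1) wl j ^+ 2 =
    2 * \sum_(j < m.+1) w j ^+ 2 by lra.
have -> : \sum_(j < m.+1) wr j ^+ 2 = \sum_(j < m) w j.+1 ^+ 2 + w m ^+ 2.
  rewrite big_ord_recr/= {2}/wr ltnn; congr (_ + _).
  by apply: eq_bigr => j _; rewrite /wr ltnS ltn_ord.
have -> : \sum_(j < m.+1) wl j ^+ 2 = w 0%N ^+ 2 + \sum_(j < m) w j ^+ 2.
  by rewrite big_ord_recl.
rewrite mulr2n mulrDl mul1r {1}big_ord_recl [in X in _ = _ + X]big_ord_recr/=.
by rewrite /bump/=; ring.
Qed.

Lemma scheme_contract J L (dt : R) (x : 'cV[R]_J) : (2 <= J)%N -> 0 <= dt ->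
  dt / dx J L ^+ 2 <= 1 / 2 -> l2norm ((1%:M + dt *: Pmat J L) *m x) <= l2norm x.
Proof.
case: J x => // m x J2 dt0 cfl.
rewrite l2norm_le ?l2norm_ge0// l2norm_sqr ler_wpM2l ?invr_ge0 ?ler0n//.
pose w j := x (inord j) 0.
have xE : x = \col_(j < m.+1) w j by apply/colP => j; rewrite mxE /w inord_val.
have := @lap_contract m w _ _ cfl.
have -> : \sum_(j < m.+1) x j 0 ^+ 2 = \sum_(j < m.+1) w j ^+ 2.
  by apply: eq_bigr => j _; rewrite {1}xE mxE.
move=> h; apply: le_trans (h _); last by rewrite divr_ge0// sqr_ge0.
rewrite le_eqVlt; apply/orP; left; apply/eqP; apply: eq_bigr => j _; congr (_ ^+ 2).
rewrite mulmxDl mul1mx -scalemxAl !mxE; congr (_ + _); first by rewrite {1}xE mxE.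
by have := Pmat_mul L w j J2; rewrite -xE mxE => ->; rewrite mulrA.
Qed.

Lemma scheme_stability J L (dt : R) (b : 'cV[R]_J) (v W d : nat -> 'cV[R]_J) :
  (2 <= J)%N -> 0 <= dt -> dt / dx J L ^+ 2 <= 1 / 2 ->
  (forall n, v n.+1 = (1%:M + dt *: Pmat J L) *m v n + dt *: b) ->
  (forall n, Pmat J L *m W n + b = d n) ->
  forall n, l2norm (W n - v n) <= l2norm (W 0%N - v 0%N)
    + \sum_(m < n) l2norm (W m.+1 - W m - dt *: d m).
Proof.
move=> J2 dt0 cfl vE WE; elim=> [|n IH]; first by rewrite big_ord0 addr0.
have -> : W n.+1 - v n.+1 = (1%:M + dt *: Pmat J L) *m (W n - v n)
    + (W n.+1 - W n - dt *: d n).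
  rewrite vE -WE mulmxBr !mulmxDl !mul1mx -!scalemxAl scalerDr.
  by apply/colP => j; rewrite !mxE; ring.
rewrite big_ord_recr/= [leRHS]addrA.
apply: le_trans (l2norm_triangle _ _) _; rewrite lerD2r.
exact: le_trans (scheme_contract _ J2 dt0 cfl) IH.
Qed.

End Discrete.

(** * Nodes, cells and the elliptic projection *)

Section Grid.
Variable R : realType.
Implicit Types (F G : R -> R) (L p q a b : R).

Definition primitive_on L G F := forall x, 0 <= x <= L -> F x = F 0 + int_ab 0 x G.

Lemma primitive_onE L G F p q : continuous G -> primitive_on L G F -> 0 <= p -> p <= q -> q <= L ->
  F q - F p = int_ab p q G.
Proof.
move=> cG FG p0 pq qL.
rewrite (FG q) ?(le_trans p0)//= (FG p) ?p0 ?(le_trans pq)//.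
by rewrite (int_split cG p0 pq); ring.
Qed.

Lemma osc_le L G F p q a b : continuous G -> primitive_on L G F ->
  0 <= p -> q <= L -> p <= a <= q -> p <= b <= q ->
  `|F a - F b| <= int_ab p q (fun x => `|G x|).
Proof.
move=> cG FG p0 qL.
wlog ba : a b / b <= a.
  move=> h; case: (leP b a) => [|/ltW] ab ha hb; first exact: h.
  by rewrite distrC; exact: h.
move=> /andP[pa aq] /andP[pb bq].
rewrite (primitive_onE cG FG (le_trans p0 pb) ba (le_trans aq qL)).
apply: le_trans (le_norm_int _ _ cG) _.
by apply: int_mono => //; exact: cont_norm.
Qed.

(** The sample point is arbitrary in the cell, and the error is measured by the variation over that
    cell only, so summing over cells costs no factor equal to their number. *)
Lemma rect_le L G F p q a : continuous G -> continuous F -> primitive_on L G F ->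
  0 <= p -> q <= L -> p <= a <= q ->
  `|int_ab p q F - (q - p) * F a| <= (q - p) * int_ab p q (fun x => `|G x|).
Proof.
move=> cG cF FG p0 qL paq.
have pq : p <= q by case/andP: paq => /le_trans; apply.
have -> : (q - p) * F a = int_ab p q (fun=> F a) by rewrite int_cst//; ring.
rewrite -intB//; last by move=> ?; exact: cvg_cst.
have cB : continuous (fun x => F x - F a).
  by apply: cont_sub => // ?; exact: cvg_cst.
apply: le_trans (le_norm_int _ _ cB) _.
rewrite mulrC -int_cst//; apply: le_int; first exact: cont_norm.
  by move=> ?; exact: cvg_cst.
by move=> x xpq; apply: (osc_le cG FG).
Qed.

Lemma sum_int G (s : nat -> R) n : continuous G -> (forall i, s i <= s i.+1) ->
  \sum_(i < n) int_ab (s i) (s i.+1) G = int_ab (s 0%N) (s n) G.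
Proof.
move=> cG s1; elim: n => [|n IH]; first by rewrite big_ord0 int_pt.
have s0n : s 0%N <= s n by elim: n {IH} => // n IH; exact: le_trans IH (s1 n).
by rewrite big_ord_recr/= IH -int_split.
Qed.

Variables (L : R) (m : nat).
Hypothesis L0 : 0 < L.
(** Writing [J] as [m.+2] builds in [2 <= J] and lets [J.-1] compute. Below, [xn] runs through the
    nodes, at distance [L / (J - 1)], and [yn] through the interfaces of the [J] cells of width
    [L / J]. *)
Let J := m.+2.
Let dxJ := dx J L.
Let h := L / J%:R.
Let xn (i : nat) : R := node J L i.
Let yn (i : nat) : R := i%:R * h.

Let J0 : 0 < J%:R :> R. Proof. by rewrite ltr0Sn. Qed.
Let J1 : 0 < m.+1%:R :> R. Proof. by rewrite ltr0Sn. Qed.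
Let JE : J%:R = m.+1%:R + 1 :> R. Proof. by rewrite natr1. Qed.
Let h0 : 0 < h. Proof. by rewrite divr_gt0. Qed.

Lemma dx_gt0 : 0 < dxJ. Proof. by rewrite divr_gt0. Qed.

(* the ratio of the mesh size [L / (J - 1)] and of the cell width [L / J] *)
Lemma dx_div_cell : dxJ / h = 1 + dxJ / L.
Proof.
rewrite /dxJ /h /dx /= JE; field; do ?(apply/andP; split); rewrite gt_eqF// -JE.
Qed.

Let xnS i : xn i.+1 = xn i + dxJ.
Proof. by rewrite /xn /node -natr1 mulrDl mul1r. Qed.

Let ynS i : yn i.+1 = yn i + h.
Proof. by rewrite /yn -natr1 mulrDl mul1r. Qed.

Let xn0 : xn 0%N = 0. Proof. by rewrite /xn /node mul0r. Qed.
Let yn0 : yn 0%N = 0. Proof. by rewrite /yn mul0r. Qed.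

Let xn_ge0 i : 0 <= xn i.
Proof. by rewrite mulr_ge0 ?ler0n// ltW// dx_gt0. Qed.

Let yn_ge0 i : 0 <= yn i.
Proof. by rewrite mulr_ge0 ?ler0n// ltW. Qed.

Let xn_le i : (i < J)%N -> xn i <= L.
Proof.
move=> iJ; rewrite /xn /node /dx/= mulrCA ger_pMr// ler_pdivrMr// mul1r ler_nat.
by rewrite -ltnS.
Qed.

Let yn_le i : (i <= J)%N -> yn i <= L.
Proof. by move=> iJ; rewrite /yn /h mulrCA ger_pMr// ler_pdivrMr// mul1r ler_nat. Qed.

Let ynJ : yn J = L.
Proof. by rewrite /yn /h; field; rewrite gt_eqF. Qed.

Let yn_xn i : (i < J)%N -> yn i <= xn i.
Proof.
move=> iJ; rewrite /xn /node /yn ler_wpM2l ?ler0n// /h /dx/=.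
by rewrite ler_pM2l// lef_pV2 ?posrE// ler_nat.
Qed.

Let xn_yn i : (i < J)%N -> xn i <= yn i.+1.
Proof.
move=> iJ; rewrite -subr_ge0.
have -> : yn i.+1 - xn i = L * (m.+1%:R - i%:R) / (J%:R * m.+1%:R).
  rewrite /yn /xn /node /dx /h/= JE -natr1; field.
  by rewrite !gt_eqF// -JE.
apply: divr_ge0; last by apply: mulr_ge0; exact: ltW.
by apply: mulr_ge0; [exact: ltW|rewrite subr_ge0 ler_nat].
Qed.

(* The interfaces interlace with the nodes: [xn i <= yn i.+1 <= xn i.+1]. *)
Lemma node_quadrature P F G j : continuous G -> continuous F ->
  primitive_on L G F -> primitive_on L F P -> (j < J)%N ->
  `|P 0 + \sum_(i < j) dxJ * F (yn i.+1) - P (xn j)| <= dxJ * int_ab 0 L (fun x => `|G x|).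
Proof.
move=> cG cF FG PF jJ.
have xS i : xn i <= xn i.+1 by rewrite xnS lerDl ltW// dx_gt0.
rewrite (PF (xn j)) ?xn_ge0 ?xn_le//.
have -> : int_ab 0 (xn j) F = \sum_(i < j) int_ab (xn i) (xn i.+1) F.
  by rewrite sum_int// xn0.
rewrite opprD addrACA subrr add0r -sumrB.
apply: le_trans (ler_norm_sum _ _ _) _.
apply: (@le_trans _ _ (\sum_(i < j) dxJ * int_ab (xn i) (xn i.+1) (fun x => `|G x|))).
  apply: ler_sum => i _; rewrite distrC.
  have iJ : (i.+1 < J)%N by rewrite (leq_ltn_trans _ jJ).
  have -> : dxJ = xn i.+1 - xn i by rewrite xnS; ring.
  apply: (rect_le cG cF FG) => //; first exact: xn_le.
  by rewrite xn_yn ?yn_xn// ltnW.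
rewrite -mulr_sumr sum_int//; last exact: cont_norm.
rewrite ler_pM2l ?dx_gt0// xn0.
by apply: int_mono => //; [exact: cont_norm|exact: xn_le].
Qed.

Variables (fc : R -> R) (beta gamma : R).
Hypothesis cf : continuous fc.

Let r := rdx J L fc.

(* [q] stands for [u_t t] and [Ax] for [u_x t]: by the equation
   [beta + int_0^y (q - fc) = u_x y], so [flux q i] approximates [u_x (yn i.+1)]. *)
Definition flux (q : R -> R) (i : nat) : R :=
  beta - dxJ * \sum_(j < i.+1) (fc (xn j) + r) + dxJ / h * int_ab 0 (yn i.+1) q.

(** Discrete primitive of the fluxes, anchored at the left end: [A0] is meant to be [u t 0]. *)
Definition ref_sol (A0 : R) (q : R -> R) (j : nat) : R := A0 + \sum_(i < j) dxJ * flux q i.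

Definition cell_avg (q : R -> R) (j : nat) : R := h^-1 * int_ab (yn j) (yn j.+1) q.

(** The matrix takes differences of consecutive fluxes, which are [- dx (f + r)] plus [dx] times a
    cell average; the factor [dx / h] in [flux] is there for the latter. At the two ends the missing
    flux is the [beta] or [gamma] contained in [bvec]. *)
Lemma ref_sol_exact A0 (q : R -> R) : continuous q -> int_ab 0 L q = 0 ->
  gamma - beta + int_ab 0 L fc = 0 ->
  Pmat J L *m (\col_(j < J) ref_sol A0 q j) + bvec J L fc beta gamma =
    \col_(j < J) cell_avg q j.
Proof.
move=> cq q0 comp; have d0 := dx_gt0.
have yS i : yn i <= yn i.+1 by rewrite ynS lerDl ltW.
have refS i : ref_sol A0 q i.+1 - ref_sol A0 q i = dxJ * flux q i.
  by rewrite /ref_sol big_ord_recr/=; ring.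
have fluxS i : flux q i.+1 - flux q i = - dxJ * (fc (xn i.+1) + r) + dxJ * cell_avg q i.+1.
  rewrite /flux [\sum_(j < i.+2) _]big_ord_recr/= (int_split cq (yn_ge0 i.+1) (yS i.+1)).
  by rewrite /cell_avg; field; rewrite gt_eqF.
have flux0 : flux q 0 = beta - dxJ * (fc (xn 0%N) + r) + dxJ * cell_avg q 0%N.
  by rewrite /flux big_ord1 /cell_avg yn0; field; rewrite gt_eqF.
(* This flux, through [yn J = L], enters no nodal value. It equals [gamma] because [q] has zero
   mean, [r] is chosen so that [dx] times the sum of [f + r] is the integral of [f], and the data
   are compatible. *)
have fluxL : flux q m.+1 = gamma.
  rewrite /flux -/J ynJ q0 mulr0 addr0 big_split/= sumr_const card_ord -[r *+ _]mulr_natl.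
  rewrite /r /rdx -/dxJ -/J.
  have -> : beta - dxJ * (\sum_(i < J) fc (xn i) +
    J%:R * ((J%:R * dxJ)^-1 * (int_ab 0 L fc - dxJ * \sum_(j < J) fc (node J L j)))) =
    beta - int_ab 0 L fc by rewrite /xn; field; rewrite !gt_eqF.
  lra.
apply/colP => i; rewrite mxE Pmat_mul// !mxE -/r -/dxJ -/(xn i).
have dn0 : dxJ != 0 by rewrite gt_eqF.
rewrite /lap; move: (ltn_ord i); case: (nat_of_ord i) => [_|k kJ] /=.
  by rewrite refS flux0 subr0; field.
have fS := fluxS k; rewrite !refS.
case: (ltnP k.+2 J) => [kJ1|kJ1].
  have -> : (k.+1 == m.+1) = false by lia.
  have -> : flux q k.+1 = flux q k - dxJ * (fc (xn k.+1) + r) + dxJ * cell_avg q k.+1 by lra.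
  by field.
have km : k = m by lia.
have -> : (k.+1 == m.+1) = true by rewrite km eqxx.
have -> : flux q k = gamma + dxJ * (fc (xn k.+1) + r) - dxJ * cell_avg q k.+1.
  have : flux q k.+1 = gamma by rewrite km.
  lra.
by field.
Qed.

(** Cauchy-Schwarz in each cell. Since the cells have equal width, the weights [1 / J] of the
    discrete norm match the integral over [[0, L]] divided by [L]. *)
Lemma cell_avg_l2 (q : R -> R) : continuous q ->
  l2norm (\col_(j < J) cell_avg q j) ^+ 2 <= L^-1 * sqint L q.
Proof.
move=> cq; rewrite l2norm_sqr.
have yS i : yn i <= yn i.+1 by rewrite ynS lerDl ltW.
have cq2 := cont_sqr cq.
have -> : sqint L q = \sum_(j < J) int_ab (yn j) (yn j.+1) (fun x => q x ^+ 2).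
  by rewrite sum_int// yn0 ynJ.
have -> : L^-1 * \sum_(j < J) int_ab (yn j) (yn j.+1) (fun x => q x ^+ 2) =
  J%:R^-1 * \sum_(j < J) h^-1 * int_ab (yn j) (yn j.+1) (fun x => q x ^+ 2).
  by rewrite -mulr_sumr mulrA -invfM /h; congr (_^-1 * _); field; rewrite gt_eqF.
rewrite ler_pM2l ?invr_gt0//; apply: ler_sum => j _; rewrite mxE /cell_avg.
rewrite exprMn -(@ler_pM2l _ (h ^+ 2)) ?exprn_gt0// mulrA -exprMn mulfV ?gt_eqF//.
rewrite expr1n mul1r mulrA [h ^+ 2]expr2 mulfK ?gt_eqF//.
have := int_CS cq (yS j).
have -> : yn j.+1 - yn j = h by rewrite ynS; ring.
apply: le_trans; rewrite -(real_normK (num_real (int_ab _ _ q))).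
rewrite lerXn2r ?nnegrE//; last exact: le_norm_int.
by apply: int_ge0.
Qed.

(** The slope vanishes at 0, so it is bounded by the integral of [|q|], and [S] varies by at most
    [h] times that in the cell, which contains the node. *)
Lemma node_avg (S Sx q : R -> R) j : continuous S -> continuous Sx -> continuous q ->
  primitive_on L Sx S -> primitive_on L q Sx -> Sx 0 = 0 -> (j < J)%N ->
  `|S (xn j) - cell_avg S j| <= dxJ * int_ab 0 L (fun x => `|q x|).
Proof.
move=> cS cSx cq SSx Sxq Sx0 jJ.
set Q := int_ab 0 L (fun x => `|q x|).
have Q0 : 0 <= Q by apply: int_ge0.
have SxQ x : 0 <= x <= L -> `|Sx x| <= Q.
  move=> xL; rewrite -[Sx x]subr0 -Sx0.
  by apply: (osc_le cq Sxq) => //; rewrite lexx ltW.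
have yS i : yn i <= yn i.+1 by rewrite ynS lerDl ltW.
have hE : yn j.+1 - yn j = h by rewrite ynS; ring.
have := rect_le cSx cS SSx (yn_ge0 j) (yn_le jJ) (a := xn j).
rewrite yn_xn// xn_yn// hE => /(_ isT) b.
have bI : int_ab (yn j) (yn j.+1) (fun x => `|Sx x|) <= h * Q.
  apply: (@le_trans _ _ (int_ab (yn j) (yn j.+1) (fun=> Q))).
    apply: le_int; [exact: cont_norm|by move=> ?; exact: cvg_cst|].
    move=> x /andP[x1 x2]; apply: SxQ.
    by rewrite (le_trans (yn_ge0 j))// (le_trans x2)// yn_le.
  by rewrite int_cst// hE mulrC.
have -> : S (xn j) - cell_avg S j = - (h^-1 * (int_ab (yn j) (yn j.+1) S - h * S (xn j))).
  by rewrite /cell_avg; field; rewrite gt_eqF.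
rewrite normrN normrM gtr0_norm ?invr_gt0// ler_pdivrMl//.
apply: le_trans b _; rewrite ler_pM2l//; apply: le_trans bI _.
by rewrite ler_wpM2r// /h /dxJ /dx/= ler_pM2l// lef_pV2 ?posrE// ler_nat.
Qed.

(** The contributions of [f], [r] and [beta] cancel, so every spatial error is governed by
    [S = A' - A], whose second derivative is [q' - q]. What remains are cell averages of
    [A' - A - dt * q]. *)
Lemma ref_sol_increment (A A' Ax Ax' q q' : R -> R) (dt : R) :
  continuous A -> continuous A' -> continuous Ax -> continuous Ax' ->
  continuous q -> continuous q' ->
  primitive_on L Ax A -> primitive_on L Ax' A' ->
  primitive_on L (fun x => q x - fc x) Ax -> primitive_on L (fun x => q' x - fc x) Ax' ->
  Ax 0 = beta -> Ax' 0 = beta ->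
  l2norm (\col_(j < J) ref_sol (A' 0) q' j - \col_(j < J) ref_sol (A 0) q j
    - dt *: \col_(j < J) cell_avg q j) <=
  3 * dxJ * int_ab 0 L (fun x => `|q' x - q x|)
   + Num.sqrt (L^-1 * sqint L (fun x => A' x - A x - dt * q x)).
Proof.
move=> cA cA' cAx cAx' cq cq' AAx AAx' Axq Axq' Ax0 Ax0'.
pose S x := A' x - A x; pose Sx x := Ax' x - Ax x; pose p x := q' x - q x.
have cS : continuous S by exact: cont_sub.
have cSx : continuous Sx by exact: cont_sub.
have cp : continuous p by exact: cont_sub.
have cqf : continuous (fun x => q x - fc x) by exact: cont_sub.
have cqf' : continuous (fun x => q' x - fc x) by exact: cont_sub.
have SSx : primitive_on L Sx S.
  by move=> x xL; rewrite /S AAx// AAx'// /Sx intB//; ring.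
have Sxp : primitive_on L p Sx.
  by move=> x xL; rewrite /Sx Axq// Axq'// /p !intB//; ring.
have Sx0 : Sx 0 = 0 by rewrite /Sx Ax0 Ax0' subrr.
have d0 := dx_gt0.
set Q := int_ab 0 L (fun x => `|p x|).
have Q0 : 0 <= Q by apply: int_ge0.
have cg : continuous (fun x => S x - dt * q x) by apply: cont_sub => //; exact: cont_scale.
have -> : \col_(j < J) ref_sol (A' 0) q' j - \col_(j < J) ref_sol (A 0) q j
    - dt *: \col_(j < J) cell_avg q j =
  \col_(j < J) (ref_sol (A' 0) q' j - ref_sol (A 0) q j - cell_avg S j)
   + \col_(j < J) cell_avg (fun x => S x - dt * q x) j.
  apply/colP => j; rewrite !mxE /cell_avg intB//; last exact: cont_scale.
  by rewrite intZ//; ring.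
apply: le_trans (l2norm_triangle _ _) _; apply: lerD; last first.
  by rewrite -[leLHS]ger0_norm ?l2norm_ge0// -sqrtr_sqr ler_wsqrtr// cell_avg_l2.
apply: l2norm_sup; first by rewrite !mulr_ge0// ltW.
move=> j; rewrite mxE.
(* Three errors, hence the constant 3: the excess [dx / L] of [dx / h] over 1, the rectangle rule
   between nodes, and the replacement of a nodal value by a cell average. *)
have -> : ref_sol (A' 0) q' j - ref_sol (A 0) q j - cell_avg S j =
    \sum_(i < j) dxJ * (dxJ / L * Sx (yn i.+1))
    + ((S 0 + \sum_(i < j) dxJ * Sx (yn i.+1) - S (xn j)) + (S (xn j) - cell_avg S j)).
  have fE (i : 'I_j) : dxJ * flux q' i - dxJ * flux q i =
      dxJ * (dxJ / L * Sx (yn i.+1)) + dxJ * Sx (yn i.+1).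
    have iJ : (i.+1 <= J)%N := leq_trans (ltn_ord i) (ltnW (ltn_ord j)).
    rewrite Sxp ?yn_ge0 ?yn_le// Sx0 /flux /p intB// dx_div_cell; ring.
  rewrite /ref_sol.
  have -> : A' 0 + \sum_(i < j) dxJ * flux q' i - (A 0 + \sum_(i < j) dxJ * flux q i) =
      S 0 + \sum_(i < j) (dxJ * flux q' i - dxJ * flux q i) by rewrite sumrB /S; ring.
  by rewrite (eq_bigr _ (fun i _ => fE i)) big_split/=; ring.
have b1 := node_quadrature cp cSx Sxp SSx (ltn_ord j).
have b2 := node_avg cS cSx cp SSx Sxp Sx0 (ltn_ord j).
apply: le_trans (ler_normD _ _) _.
have -> : 3 * dxJ * Q = dxJ * Q + (dxJ * Q + dxJ * Q) by ring.
apply: lerD; last by apply: le_trans (ler_normD _ _) _; exact: lerD.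
apply: le_trans (ler_norm_sum _ _ _) _.
apply: (@le_trans _ _ (\sum_(i < j) dxJ * (dxJ / L * Q))).
  apply: ler_sum => i _.
  have iJ : (i.+1 <= J)%N := leq_trans (ltn_ord i) (ltnW (ltn_ord j)).
  have dL : 0 < dxJ / L by rewrite divr_gt0.
  rewrite normrM (gtr0_norm d0) ler_pM2l// normrM (gtr0_norm dL) ler_pM2l//.
  rewrite -[Sx _]subr0 -Sx0; apply: (osc_le cp Sxp) => //; last by rewrite lexx ltW.
  by rewrite yn_ge0 yn_le.
rewrite sumr_const card_ord -[leLHS]mulr_natl [leLHS]mulrA -[j%:R * dxJ]/(xn j).
apply: (@le_trans _ _ (L * (dxJ / L * Q))).
  apply: ler_wpM2r; last exact: xn_le.
  by apply: mulr_ge0 => //; apply: divr_ge0; exact: ltW.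
by rewrite le_eqVlt; apply/orP; left; apply/eqP; field; rewrite gt_eqF.
Qed.

Variable fc' : R -> R.
Hypotheses (cf' : continuous fc') (ff' : primitive_on L fc' fc).

Let Nf := int_ab 0 L (fun x => `|fc' x|).
Let M0 := L^-1 * int_ab 0 L (fun x => `|fc x|) + Nf.

Let Nf_ge0 : 0 <= Nf. Proof. by apply: int_ge0. Qed.

(** A value of [|f|] exceeds its mean by at most the total variation [Nf]. *)
Let fc_sup x : 0 <= x <= L -> `|fc x| <= M0.
Proof.
move=> xL.
have b : L * `|fc x| <= int_ab 0 L (fun y => `|fc y| + Nf).
  have -> : L * `|fc x| = int_ab 0 L (fun=> `|fc x|) by rewrite int_cst ?(ltW L0)//; ring.
  apply: le_int; first by move=> ?; exact: cvg_cst.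
    by apply: cont_add; [exact: cont_norm|move=> ?; exact: cvg_cst].
  move=> y yL; rewrite -lerBlDl; apply: le_trans (lerB_dist _ _) _.
  by apply: (osc_le cf' ff').
rewrite /M0 -(@ler_pM2l _ L)//; apply: le_trans b _.
rewrite intD; [|exact: cont_norm|by move=> ?; exact: cvg_cst].
rewrite int_cst ?(ltW L0)// le_eqVlt; apply/orP; left; apply/eqP.
by field; rewrite gt_eqF.
Qed.

Let M0_ge0 : 0 <= M0.
Proof. by apply: le_trans (fc_sup (x := 0) _); rewrite // lexx ltW. Qed.

(** The sum carries the weight [dx] while the cells have width [h]. The rectangle rule accounts for
    [Nf], the mismatch of weights for [M0], because [J (dx - h) = dx]. *)
Let cell_sum n : (n <= J)%N ->
  `|int_ab 0 (yn n) fc - dxJ * \sum_(j < n) fc (xn j)| <= dxJ * (Nf + M0).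
Proof.
move=> nJ.
have yS i : yn i <= yn i.+1 by rewrite ynS lerDl ltW.
have -> : int_ab 0 (yn n) fc = \sum_(i < n) int_ab (yn i) (yn i.+1) fc.
  by rewrite sum_int// yn0.
have -> : \sum_(i < n) int_ab (yn i) (yn i.+1) fc - dxJ * \sum_(j < n) fc (xn j) =
    \sum_(i < n) (int_ab (yn i) (yn i.+1) fc - h * fc (xn i))
    - \sum_(i < n) (dxJ - h) * fc (xn i).
  by rewrite sumrB -!mulr_sumr; ring.
apply: le_trans (ler_normB _ _) _; rewrite mulrDr; apply: lerD.
  apply: le_trans (ler_norm_sum _ _ _) _.
  apply: (@le_trans _ _ (\sum_(i < n) h * int_ab (yn i) (yn i.+1) (fun x => `|fc' x|))).
    apply: ler_sum => i _.
    have iJ : (i < J)%N by rewrite (leq_trans _ nJ).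
    have -> : h = yn i.+1 - yn i by rewrite ynS; ring.
    apply: (rect_le cf' cf ff') => //; first exact: yn_le.
    by rewrite yn_xn ?xn_yn.
  rewrite -mulr_sumr sum_int//; last exact: cont_norm.
  rewrite yn0; apply: ler_pM => //; first exact: ltW.
  - exact: int_ge0.
  - by rewrite /h /dxJ /dx/= ler_pM2l// lef_pV2 ?posrE// ler_nat.
  - by apply: int_mono => //; [exact: cont_norm|exact: yn_le].
apply: le_trans (ler_norm_sum _ _ _) _.
have dh : 0 <= dxJ - h.
  by rewrite subr_ge0 /h /dxJ /dx/= ler_pM2l// lef_pV2 ?posrE// ler_nat.
apply: (@le_trans _ _ (\sum_(i < n) (dxJ - h) * M0)).
  apply: ler_sum => i _; rewrite normrM ger0_norm// ler_wpM2l// fc_sup//.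
  by rewrite xn_ge0 xn_le// (leq_trans _ nJ).
rewrite sumr_const card_ord -mulr_natl.
apply: (@le_trans _ _ (J%:R * ((dxJ - h) * M0))).
  by rewrite ler_wpM2r ?mulr_ge0// ler_nat.
rewrite mulrA ler_wpM2r//.
rewrite le_eqVlt; apply/orP; left; apply/eqP.
by rewrite /dxJ /h /dx/= JE; field; rewrite !gt_eqF// -JE.
Qed.

(** Adding [r] to the first [n] terms spreads out the fraction [n / J] of the total quadrature
    error, which [cell_sum] bounds as well; hence the factor 2. *)
Let cell_sum_r n : (n <= J)%N ->
  `|int_ab 0 (yn n) fc - dxJ * \sum_(j < n) (fc (xn j) + r)| <= 2 * (dxJ * (Nf + M0)).
Proof.
move=> nJ.
have -> : int_ab 0 (yn n) fc - dxJ * \sum_(j < n) (fc (xn j) + r) =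
    (int_ab 0 (yn n) fc - dxJ * \sum_(j < n) fc (xn j))
    - n%:R / J%:R * (int_ab 0 (yn J) fc - dxJ * \sum_(j < J) fc (xn j)).
  rewrite big_split/= sumr_const card_ord -[r *+ n]mulr_natl ynJ /r /rdx -/dxJ.
  by field; rewrite !gt_eqF// dx_gt0.
apply: le_trans (ler_normB _ _) _.
have nJ0 : 0 <= n%:R / J%:R :> R by rewrite divr_ge0// ltW.
have -> : 2 * (dxJ * (Nf + M0)) = dxJ * (Nf + M0) + 1 * (dxJ * (Nf + M0)) by ring.
apply: lerD; first exact: cell_sum.
rewrite normrM (ger0_norm nJ0); apply: ler_pM => //; last exact: cell_sum.
by rewrite ler_pdivrMr// mul1r ler_nat.
Qed.

(** Each flux differs from [Ax] at its interface by the excess [dx / L] of [dx / h] over 1, times an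
    integral of [q], and by the quadrature error for [f]. Summation over nodes multiplies this by at
    most [L]; the last term is the rectangle rule for [Ax]. *)
Lemma ref_sol_consistent (A Ax q : R -> R) j :
  continuous q -> primitive_on L Ax A -> continuous Ax ->
  primitive_on L (fun x => q x - fc x) Ax -> Ax 0 = beta -> (j < J)%N ->
  `|ref_sol (A 0) q j - A (xn j)| <=
    dxJ * (int_ab 0 L (fun x => `|q x|) + 2 * L * (Nf + M0)
           + int_ab 0 L (fun x => `|q x - fc x|)).
Proof.
move=> cq AAx cAx AxAxx Ax0 jJ.
have cqf : continuous (fun x => q x - fc x) by exact: cont_sub.
set a := int_ab 0 L (fun x => `|q x|).
have a0 : 0 <= a by apply: int_ge0.
have -> : ref_sol (A 0) q j - A (xn j) =
    \sum_(i < j) dxJ * (flux q i - Ax (yn i.+1))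
    + (A 0 + \sum_(i < j) dxJ * Ax (yn i.+1) - A (xn j)).
  rewrite /ref_sol -!mulr_sumr sumrB; ring.
apply: le_trans (ler_normD _ _) _; rewrite mulrDr; apply: lerD; last first.
  exact: node_quadrature.
apply: le_trans (ler_norm_sum _ _ _) _.
apply: (@le_trans _ _ (\sum_(i < j) dxJ * (dxJ / L * a + 2 * (dxJ * (Nf + M0))))).
  apply: ler_sum => i _.
  have iJ : (i.+1 <= J)%N by rewrite (leq_ltn_trans _ jJ)// ltnW.
  rewrite normrM gtr0_norm ?dx_gt0// ler_pM2l ?dx_gt0//.
  have -> : flux q i - Ax (yn i.+1) = dxJ / L * int_ab 0 (yn i.+1) q
      + (int_ab 0 (yn i.+1) fc - dxJ * \sum_(j < i.+1) (fc (xn j) + r)).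
    rewrite /flux dx_div_cell AxAxx ?yn_ge0 ?yn_le// Ax0 intB//; ring.
  apply: le_trans (ler_normD _ _) _; apply: lerD; last exact: cell_sum_r.
  have dL : 0 < dxJ / L by rewrite divr_gt0// dx_gt0.
  rewrite normrM gtr0_norm// ler_pM2l//.
  apply: le_trans (le_norm_int _ _ cq) _.
  by apply: int_mono => //; [exact: cont_norm|exact: yn_le].
rewrite sumr_const card_ord -[leLHS]mulr_natl.
set K := dxJ / L * a + 2 * (dxJ * (Nf + M0)).
have K0 : 0 <= K.
  have d0 := dx_gt0.
  apply: addr_ge0; first by apply: mulr_ge0 => //; apply: divr_ge0; exact: ltW.
  by apply: mulr_ge0 => //; apply: mulr_ge0; [exact: ltW|exact: addr_ge0].
rewrite [leLHS]mulrA; apply: (@le_trans _ _ (L * K)).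
  by rewrite ler_wpM2r// -[j%:R * dxJ]/(xn j) xn_le.
rewrite le_eqVlt; apply/orP; left; apply/eqP.
by rewrite /K; field; rewrite gt_eqF.
Qed.

End Grid.

(** * The error bound for data extended to the whole line *)

Section SchemeError.
Variables (R : realType) (L : R).
Hypothesis L0 : 0 < L.

Let sL := Num.sqrt L.
Let sL0 : 0 < sL. Proof. by rewrite sqrtr_gt0. Qed.
Let sL2 : sL ^+ 2 = L. Proof. by rewrite sqr_sqrtr// ltW. Qed.

Lemma int_norm_le (g : R -> R) (X : R) : continuous g -> 0 <= X ->
  sqint L g <= X ^+ 2 -> int_ab 0 L (fun x => `|g x|) <= sL * X.
Proof.
move=> cg X0 gX.
have i0 : 0 <= int_ab 0 L (fun x => `|g x|) by apply: int_ge0.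
have sX : 0 <= sL * X by rewrite mulr_ge0// ltW.
rewrite -(@ler_pXn2r _ 2)// ?nnegrE// exprMn sL2.
apply: le_trans (int_CS cg (ltW L0)) _.
by rewrite subr0 ler_pM2l.
Qed.

Definition sdecay (t : R) : R := expR (- (L ^+ 2)^-1 * t).

Lemma sdecay_sqr t : sdecay t ^+ 2 = decay L t.
Proof. by rewrite /sdecay /decay expr2 -expRD; congr expR; field; rewrite gt_eqF. Qed.

(** A geometric series of ratio [q], bounded by [dt / (1 - q)]. With [c = 1 / L^2],
    [expR x >= 1 + x] gives [1 - q >= c dt / (1 + c dt)], which is at least [c dt / (1 + c)] as
    [dt < 1]; and [(1 + c) / c = L^2 + 1]. *)
Lemma sum_sdecay (dt : R) n : 0 < dt < 1 ->
  \sum_(m < n) dt * sdecay (m%:R * dt) <= L ^+ 2 + 1.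
Proof.
move=> /andP[dt0 dt1].
set c := (L ^+ 2)^-1.
have c0 : 0 < c by rewrite invr_gt0 exprn_gt0.
set q := sdecay dt.
have q0 : 0 < q by exact: expR_gt0.
have q1 : dt <= (L ^+ 2 + 1) * (1 - q).
  have : (1 + c * dt) * q <= 1.
    rewrite [leRHS](_ : 1 = expR (c * dt) * q); last first.
      by rewrite /q /sdecay -expRD mulNr subrr expR0.
    by rewrite ler_pM2r// expR_ge1Dx.
  have -> : L ^+ 2 = c^-1 by rewrite /c invrK.
  have cdt : 0 < 1 + c * dt by rewrite addr_gt0 ?mulr_gt0.
  rewrite -ler_pdivlMl// mulr1 => hq.
  have : (1 + c * dt)^-1 <= 1 - c * dt / (1 + c).
    rewrite -div1r ler_pdivrMr//.
    have -> : (1 - c * dt / (1 + c)) * (1 + c * dt) = 1 + c ^+ 2 * dt * (1 - dt) / (1 + c).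
      by field; rewrite gt_eqF// addr_gt0.
    rewrite lerDl divr_ge0 ?addr_ge0 ?ltW// !mulr_gt0 ?exprn_gt0//; lra.
  move=> h2.
  have : c * dt / (1 + c) <= 1 - q by lra.
  have -> : c * dt / (1 + c) = dt / (c^-1 + 1) by field; rewrite !gt_eqF// addr_gt0.
  rewrite ler_pdivrMr; first by rewrite mulrC.
  by apply: addr_gt0 => //; rewrite invr_gt0.
have qm m : sdecay (m%:R * dt) = q ^+ m.
  by rewrite /q /sdecay -expRM_natl; congr expR; rewrite -mulr_natl; ring.
suff : \sum_(m < n) dt * sdecay (m%:R * dt) <= (L ^+ 2 + 1) * (1 - q ^+ n).
  move/le_trans; apply; rewrite ger_pMr; last by rewrite addr_gt0 ?exprn_gt0.
  by rewrite gerBl exprn_ge0// ltW.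
elim: n => [|n IH]; first by rewrite big_ord0 expr0 subrr mulr0.
rewrite big_ord_recr/= qm.
have -> : (L ^+ 2 + 1) * (1 - q ^+ n.+1) =
  (L ^+ 2 + 1) * (1 - q ^+ n) + (L ^+ 2 + 1) * (1 - q) * q ^+ n by rewrite [q ^+ n.+1]exprS; ring.
by apply: lerD => //; rewrite ler_pM2r// exprn_gt0.
Qed.

Variable m : nat.
Let J := m.+2.
Variables (beta gamma : R) (U UX UXX UT : R -> R -> R) (fc fc' phi psi UX0 : R -> R).
Variables (WX WXX WT : R -> R -> R).
Hypothesis HU : neumann_heat L beta gamma U UX UXX UT (fun _ => fc).
Hypothesis HW : neumann_heat L 0 0 (fun t x => U t x - U 0 x - t * phi x) WX WXX WT
  (fun t x => t * psi x).
Hypotheses (cf : continuous fc) (cf' : continuous fc') (ff' : primitive_on L fc' fc).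
Hypotheses (cphi : continuous phi) (cpsi : continuous psi) (cUX0 : continuous UX0).
Hypotheses (U0x : primitive_on L UX0 (U 0)) (UX0x : primitive_on L (fun x => phi x - fc x) UX0).
Hypotheses (UX00 : UX0 0 = beta) (UX0L : UX0 L = gamma).
Hypothesis comp : gamma - beta + int_ab 0 L fc = 0.
Variable N : R.
Hypothesis N0 : 0 <= N.
Hypotheses (phiN : sqint L phi <= 2 * N ^+ 2) (psiN : sqint L psi <= 2 * N ^+ 2).
Hypotheses (fN : sqint L fc <= N ^+ 2) (f'N : sqint L fc' <= N ^+ 2).

Let q (t : R) := ut_ext UT phi t.
(** Nothing is assumed about the space derivative of the solution at time 0. With that of the
    initial datum put in there, [U], [Ux] and [q] satisfy the same identities at all times
    [t >= 0]. *)
Let Ux (t : R) := if 0 < t then UX t else UX0.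

Let zL : 0 <= L <= L. Proof. by rewrite lexx ltW. Qed.
Let z0 : (0 : R) <= 0 <= L. Proof. by rewrite lexx ltW. Qed.

Let Ux_cont (t : R) : continuous (Ux t).
Proof. by rewrite /Ux; case: ifPn => // t0; exact: (nh_cx HU). Qed.

Let q_cont (t : R) : continuous (q t).
Proof. exact: (ut_ext_cont HU cphi). Qed.

Let U_Ux (t : R) : 0 <= t -> primitive_on L (Ux t) (U t).
Proof.
rewrite le_eqVlt /Ux => /predU1P[<-|t0]; first by rewrite ltxx.
by rewrite t0 => x; exact: (nh_x HU).
Qed.

Let Ux0 (t : R) : 0 <= t -> Ux t 0 = beta.
Proof.
rewrite le_eqVlt /Ux => /predU1P[<-|t0]; first by rewrite ltxx.
by rewrite t0 (nh_xx HU t0 z0) int_pt addr0.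
Qed.

Let Ux_q (t : R) : 0 <= t -> primitive_on L (fun x => q t x - fc x) (Ux t).
Proof.
move=> t0 x xL; rewrite (Ux0 t0); move: t0.
rewrite le_eqVlt /Ux /q /ut_ext => /predU1P[<-|t0].
  by rewrite ltxx UX0x// UX00.
rewrite t0 (nh_xx HU t0 xL); congr (_ + _).
have /andP[x0 xL'] := xL.
apply: eq_int_oo => //; first exact: (nh_cxx HU).
  by apply: cont_sub => //; exact: (nh_czt HU).
move=> y /andP[y0 yx]; rewrite -(nh_eq HU t0 (x := y)); first by ring.
by rewrite y0 (lt_le_trans yx).
Qed.

Let UxL (t : R) : 0 <= t -> Ux t L = gamma.
Proof.
rewrite le_eqVlt /Ux => /predU1P[<-|t0]; first by rewrite ltxx.
by rewrite t0 (nh_b1 HU).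
Qed.

Let int_q (t : R) : 0 <= t -> int_ab 0 L (q t) = 0.
Proof.
move=> t0; have := Ux_q t0 zL; rewrite (UxL t0) (Ux0 t0) intB; [|exact: q_cont|by []].
move=> E; have {}E : gamma = beta + (int_ab 0 L (q t) - int_ab 0 L fc) by [].
move: comp E; lra.
Qed.

Let mass (t : R) : 0 < t -> int_ab 0 L (UT t) = 0.
Proof. by move=> t0; have := int_q (ltW t0); rewrite /q /ut_ext t0. Qed.

Let W (t : R) : 'cV[R]_J := \col_(j < J) ref_sol L m fc beta (U t 0) (q t) j.
Let Pi_U (t : R) : 'cV[R]_J := \col_(j < J) U t (node J L j).
(** [K1] collects the bounds of [ref_sol_consistent]: in units of [sL * N], 2 for [q], [4 L + 2] for
    [Nf + M0], and 3 for [q - f]. [K2] comes from [ref_sol_increment]: 3 with the factor [sL] of L^1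
    against L^2, and [1 / sL] for the Taylor remainder. *)
Let K1 := sL * (7 + 4 * L).
Let K2 := 2 * Num.sqrt (expR 1) * (3 * sL + sL^-1).

Let K1_ge0 : 0 <= K1.
Proof.
apply: mulr_ge0; first exact: ltW.
by apply: addr_ge0 => //; apply: mulr_ge0 => //; exact: ltW.
Qed.

Let K2_ge0 : 0 <= K2.
Proof.
apply: mulr_ge0; first by rewrite mulr_ge0// sqrtr_ge0.
by rewrite addr_ge0 ?invr_ge0 ?mulr_ge0// ltW.
Qed.

Let W_close (t : R) : 0 <= t -> l2norm (Pi_U t - W t) <= dx J L * (K1 * N).
Proof.
move=> t0; have d0 := dx_gt0 m L0.
have K1N : 0 <= K1 * N by exact: mulr_ge0.
apply: l2norm_sup; first by rewrite mulr_ge0// ltW.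
move=> j; rewrite !mxE distrC.
apply: le_trans (ref_sol_consistent L0 cf cf' ff' (q_cont (t := t)) (U_Ux t0)
  (Ux_cont (t := t)) (Ux_q t0) (Ux0 t0) (ltn_ord j)) _.
rewrite ler_pM2l//.
have bq : int_ab 0 L (fun x => `|q t x|) <= sL * (2 * N).
  apply: int_norm_le; [exact: q_cont|by rewrite mulr_ge0|].
  apply: le_trans (sqint_ut_ext L0 HU HW cphi cpsi mass t) _.
  by rewrite exprMn; move: phiN; lra.
have bf := int_norm_le cf N0 fN.
have bf' := int_norm_le cf' N0 f'N.
have bqf : int_ab 0 L (fun x => `|q t x - fc x|) <=
    int_ab 0 L (fun x => `|q t x|) + int_ab 0 L (fun x => `|fc x|).
  have cq := q_cont (t := t).
  rewrite -intD; [|exact: cont_norm|exact: cont_norm].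
  apply: le_int; [by apply: cont_norm; exact: cont_sub|by apply: cont_add; exact: cont_norm|].
  by move=> x _; exact: ler_normB.
move: bq bf bf' bqf.
set A := int_ab _ _ _; set B := int_ab _ _ _; set C := int_ab _ _ _; set D := int_ab _ _ _.
move=> bq bf bf' bqf.
have e1 : 2 * L * (C + (L^-1 * B + C)) = 4 * L * C + 2 * B.
  by field; rewrite gt_eqF.
have e2 : 4 * L * C <= 4 * L * (sL * N) by rewrite ler_pM2l// mulr_gt0.
rewrite e1 /K1.
have -> : sL * (7 + 4 * L) * N = 7 * (sL * N) + 4 * L * (sL * N) by ring.
move: bq; rewrite mulrCA; lra.
Qed.

Let W_increment (t dt : R) : 0 <= t -> 0 < dt ->
  l2norm (W (t + dt) - W t - dt *: \col_(j < J) cell_avg L m (q t) j) <=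
    dt * sdecay t * ((dx J L + dt) * K2 * N).
Proof.
move=> t0 dt0; have d0 := dx_gt0 m L0.
have tdt : 0 <= t + dt by rewrite addr_ge0// ltW.
have := ref_sol_increment m L0 cf dt (nh_cz HU t0) (nh_cz HU tdt) (Ux_cont (t := t))
  (Ux_cont (t := t + dt)) (q_cont (t := t)) (q_cont (t := t + dt))
  (U_Ux t0) (U_Ux tdt) (Ux_q t0) (Ux_q tdt) (Ux0 t0) (Ux0 tdt).
move/le_trans; apply.
set s := Num.sqrt (expR 1) : R.
have s0 : 0 < s by rewrite sqrtr_gt0 expR_gt0.
have s2 : s ^+ 2 = expR 1 by rewrite sqr_sqrtr// expR_ge0.
have ed0 : 0 < sdecay t by exact: expR_gt0.
have dP k : 0 <= k -> decay L t * (2 * expR 1 * k * sqint L psi) <=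
    decay L t * (2 * expR 1 * k * (2 * N ^+ 2)).
  move=> k0; by rewrite ler_wpM2l ?decay_ge0// ler_wpM2l// mulr_ge0// mulr_ge0// expR_ge0.
have b1 : int_ab 0 L (fun x => `|q (t + dt) x - q t x|) <= sL * (2 * s * sdecay t * dt * N).
  apply: int_norm_le.
  - by apply: cont_sub; exact: q_cont.
  - by rewrite !mulr_ge0// ltW.
  apply: le_trans (sqint_ut_ext_diff L0 HU HW cphi cpsi mass t0 dt0) _.
  apply: le_trans (dP _ (sqr_ge0 _)) _.
  rewrite -s2 -sdecay_sqr le_eqVlt; apply/orP; left; apply/eqP; ring.
have b2 : Num.sqrt (L^-1 * sqint L (fun x => U (t + dt) x - U t x - dt * q t x)) <=
    sL^-1 * (2 * s * sdecay t * dt ^+ 2 * N).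
  have r0 : 0 <= sL^-1 * (2 * s * sdecay t * dt ^+ 2 * N).
    by rewrite !mulr_ge0 ?invr_ge0 ?sqr_ge0// ltW.
  rewrite -[leRHS](ger0_norm r0) -sqrtr_sqr ler_wsqrtr//.
  rewrite exprMn exprVn sL2 ler_pM2l ?invr_gt0//.
  apply: le_trans (sqint_ut_ext_taylor L0 HU HW cpsi mass t0 dt0) _.
  apply: le_trans (dP _ (exprn_ge0 4 (ltW dt0))) _.
  rewrite -s2 -sdecay_sqr le_eqVlt; apply/orP; left; apply/eqP; ring.
have b1' : 3 * dx J L * int_ab 0 L (fun x => `|q (t + dt) x - q t x|) <=
    3 * dx J L * (sL * (2 * s * sdecay t * dt * N)).
  by rewrite ler_pM2l// mulr_gt0.
apply: le_trans (lerD b1' b2) _.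
rewrite -subr_ge0.
have -> : dt * sdecay t * ((dx J L + dt) * K2 * N) -
   (3 * dx J L * (sL * (2 * s * sdecay t * dt * N)) + sL^-1 * (2 * s * sdecay t * dt ^+ 2 * N)) =
   2 * s * sdecay t * dt * N * (dx J L * sL^-1 + dt * (3 * sL)).
  by rewrite /K2 -/s; ring.
have sV : 0 < sL^-1 by rewrite invr_gt0.
apply: mulr_ge0; first by rewrite !mulr_ge0// ltW.
by rewrite addr_ge0// !mulr_ge0// ltW.
Qed.

(** [K1] is counted twice because [W] replaces the solution both at the final and at the initial
    time; [(L^2 + 1) K2] is the sum of the defects. *)
Lemma scheme_error (dt : R) (v : nat -> 'cV[R]_J) :
  0 < dt < 1 -> dt / dx J L ^+ 2 <= 1 / 2 ->
  (forall n, v n.+1 = (1%:M + dt *: Pmat J L) *m v n + dt *: bvec J L fc beta gamma) ->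
  forall n, l2norm (Pi_U (n%:R * dt) - v n) <= l2norm (Pi_U 0 - v 0%N) +
    (2 * K1 + (L ^+ 2 + 1) * K2) * (dx J L + dt) * N.
Proof.
move=> dt01 cfl vE n; have /andP[dt0 dt1] := dt01; have d0 := dx_gt0 m L0.
have tn k : 0 <= k%:R * dt by rewrite mulr_ge0// ltW.
have WE k : Pmat J L *m W (k%:R * dt) + bvec J L fc beta gamma =
    \col_(j < J) cell_avg L m (q (k%:R * dt)) j.
  exact: (ref_sol_exact m L0 _ (q_cont (t := _)) (int_q (tn k)) comp).
have := scheme_stability (isT : (2 <= J)%N) (ltW dt0) cfl vE WE n.
rewrite mul0r => stab.
have inc : \sum_(k < n) l2norm (W (k.+1%:R * dt) - W (k%:R * dt) -
     dt *: \col_(j < J) cell_avg L m (q (k%:R * dt)) j) <=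
    (L ^+ 2 + 1) * ((dx J L + dt) * K2 * N).
  apply: (@le_trans _ _ (\sum_(k < n) dt * sdecay (k%:R * dt) * ((dx J L + dt) * K2 * N))).
    apply: ler_sum => k _.
    have -> : k.+1%:R * dt = k%:R * dt + dt by rewrite -natr1; ring.
    exact: W_increment.
  rewrite -mulr_suml ler_wpM2r ?sum_sdecay//.
  apply: mulr_ge0 => //; apply: mulr_ge0 => //.
  by rewrite addr_ge0// ltW.
have -> : Pi_U (n%:R * dt) - v n = (Pi_U (n%:R * dt) - W (n%:R * dt)) + (W (n%:R * dt) - v n).
  by rewrite addrA subrK.
apply: le_trans (l2norm_triangle _ _) _.
have w0 : l2norm (W 0 - v 0%N) <= dx J L * (K1 * N) + l2norm (Pi_U 0 - v 0%N).
  have -> : W 0 - v 0%N = - (Pi_U 0 - W 0) + (Pi_U 0 - v 0%N).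
    by rewrite opprB addrA subrK.
  apply: le_trans (l2norm_triangle _ _) _.
  by rewrite l2normN lerD2r; exact: W_close.
have wn := W_close (tn n).
have K1N : 0 <= dt * (K1 * N).
  by apply: mulr_ge0; [exact: ltW|exact: mulr_ge0].
have -> : (2 * K1 + (L ^+ 2 + 1) * K2) * (dx J L + dt) * N =
   2 * (dx J L * (K1 * N)) + 2 * (dt * (K1 * N)) + (L ^+ 2 + 1) * ((dx J L + dt) * K2 * N).
  by ring.
lra.
Qed.

End SchemeError.

(** * From functions on the segment to functions on the line *)

Section Extension.
Variables (R : realType) (L : R).
Hypothesis L0 : 0 < L.
Notation ext g := (fun x => g (clamp L x)).

Let L0' : 0 <= L. Proof. exact: ltW. Qed.

Lemma int_ext (g : R -> R) x : x <= L -> int_ab 0 x (ext g) = int_ab 0 x g.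
Proof.
move=> xL; apply: eq_int => y /andP[y0 yx].
by rewrite clamp_id// y0 (le_trans yx).
Qed.

Lemma deriv_chain_primitive k u g i : deriv_chain k L u g -> (i < k)%N ->
  primitive_on L (ext (g i.+1)) (ext (g i)).
Proof.
move=> [_ H] ik x xL; have [_ /(_ x xL)] := H i ik.
by rewrite !clamp_id ?lexx// int_ext//; case/andP: xL.
Qed.

Lemma deriv_chain_cont k u g i : deriv_chain k L u g -> (i < k)%N ->
  continuous (ext (g i)).
Proof.
move=> [_ H] ik; have [ig gE] := H i ik.
apply: cont_clamp => //.
apply: (@subspace_eq_continuous _ _ _ (fun x => g i 0 + int_ab 0 x (g i.+1))).
  by move=> x; rewrite inE/= in_itv/= => xL; exact/esym/gE.
have c := @parameterized_integral_continuous R 0 L (g i.+1) L0' ig.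
move=> x; apply: (@cvgD _ R^o); first exact: cvg_cst.
exact: c.
Qed.

Lemma Hnorm_ge0 s g : 0 <= Hnorm s L g.
Proof. exact: sqrtr_ge0. Qed.

Lemma sqint_Hnorm s (g : nat -> R -> R) i : (i <= s)%N ->
  sqint L (ext (g i)) <= Hnorm s L g ^+ 2.
Proof.
move=> si; rewrite /Hnorm.
have i0 k : 0 <= int_ab 0 L (fun x => g k x ^+ 2).
  by apply: int_ge0 => x _; exact: sqr_ge0.
rewrite sqr_sqrtr; last by apply: sumr_ge0.
have si' : (i < s.+1)%N by [].
rewrite (bigD1 (Ordinal si'))//=.
rewrite (@eq_sqint _ _ _ (g i)); last by move=> x xL; rewrite clamp_id.
by rewrite /sqint lerDl sumr_ge0.
Qed.

Lemma neumann_heat_of_solution f beta gamma u0 u : heat_solution L f beta gamma u0 u ->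
  exists UX UXX UT,
    neumann_heat L beta gamma (fun t => ext (u t)) UX UXX UT (fun _ => ext f).
Proof.
move=> [ux [uxx [ut [cu [cx [cxx [ct [hx [ht [he [_ hb]]]]]]]]]]].
(* For positive times clamping in [x] suffices, as these times form an open set. The solution
   itself, continuous up to time 0, is truncated in time too. *)
have cG (G : R -> R -> R) :
  {within [set p : R * R | 0 < p.1 /\ 0 <= p.2 <= L], continuous (fun p : R * R => G p.1 p.2)} ->
  forall t x : R, 0 < t -> {for (t, x), continuous (fun q : R * R => G q.1 (clamp L q.2))}.
  move=> cG t x t0.
  apply: (@within_comp (R * R)%type (R * R)%type R _ _ (fun q : R * R => (q.1, clamp L q.2)) _ cG).
    apply: (@continuous_pair _ _ _ (fun q : R * R => q.1) (fun q : R * R => clamp L q.2)).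
      exact: cvg_fst.
    by apply: (@continuous_comp _ _ _ snd (clamp L)); [exact: cvg_snd|exact: clamp_cont].
  have cf : {for ((t, x) : R * R), continuous (fun q : R * R => q.1)} by exact: cvg_fst.
  have It : t \in `]0, (t + 1)[ by rewrite in_itv/= t0 ltrDl ltr01.
  have := cf _ (near_in_itvoo It).
  apply: (@filterS _ (nbhs ((t, x) : R * R)) (nbhs_filter _)) => q /=.
  by rewrite in_itv/= => /andP[q0 _]; split => //; exact: clamp_in.
have cGx (G : R -> R -> R) :
  {within [set p : R * R | 0 < p.1 /\ 0 <= p.2 <= L], continuous (fun p : R * R => G p.1 p.2)} ->
  forall t : R, 0 < t -> continuous (ext (G t)).
  move=> c t t0 x; apply: (@continuous_sect1 _ (fun s y => G s (clamp L y)) t x).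
  exact: (cG _ c).
have c0 : clamp L 0 = 0 by rewrite clamp_id// lexx ltW.
exists (fun t => ext (ux t)), (fun t => ext (uxx t)), (fun t => ext (ut t)); split.
- move=> q; apply: (@within_comp (R * R)%type (R * R)%type R _ _
    (fun q : R * R => (Num.max 0 q.1, clamp L q.2)) _ cu).
    apply: (@continuous_pair _ _ _ (fun q : R * R => Num.max 0 q.1) (fun q : R * R => clamp L q.2)).
      by apply: (@continuous_max R _ (fun=> 0) (fun q : R * R => q.1));
        [exact: cvg_cst|exact: cvg_fst].
    by apply: (@continuous_comp _ _ _ snd (clamp L)); [exact: cvg_snd|exact: clamp_cont].
  apply: (@filterE _ _ (nbhs_filter q)) => y /=.
  by split; [rewrite le_max lexx|exact: clamp_in].
- exact: cGx.
- exact: cGx.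
- exact: (cG ut).
- move=> t x t0 xL; have [h _] := hx t x t0 xL.
  by rewrite c0 clamp_id// int_ext//; case/andP: xL.
- move=> t x t0 xL; have [_ h] := hx t x t0 xL; have [b _] := hb t t0.
  by rewrite clamp_id// int_ext -?b//; case/andP: xL.
- by move=> t t0; have [_ b] := hb t t0; rewrite clamp_id// lexx ltW.
- by move=> t x t0; apply: ht => //; exact: clamp_in.
- move=> t x t0 xL; have /andP[x0 xL'] := xL.
  by rewrite clamp_id ?he// !ltW.
Qed.

(** Meant for [a = u0] and [b = phi = u0'' + f]: the source is then [f - t phi''], so that
    subtracting this function from the solution leaves the source [t phi'']. *)
Lemma neumann_heat_affine (beta gamma : R) (a a1 a2 b b1 b2 : R -> R) :
  continuous a -> continuous a1 -> continuous a2 ->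
  continuous b -> continuous b1 -> continuous b2 ->
  primitive_on L a1 a -> primitive_on L a2 a1 -> primitive_on L b1 b -> primitive_on L b2 b1 ->
  a1 0 = beta -> a1 L = gamma -> b1 0 = 0 -> b1 L = 0 ->
  neumann_heat L beta gamma (fun t x => a x + t * b x) (fun t x => a1 x + t * b1 x)
    (fun t x => a2 x + t * b2 x) (fun _ => b) (fun t x => b x - (a2 x + t * b2 x)).
Proof.
move=> ca ca1 ca2 cb cb1 cb2 pa pa1 pb pb1 a10 a1L b10 b1L.
have cs (g : R -> R) : continuous g -> continuous (fun q : R * R => g q.2).
  by move=> cg q; apply: (@continuous_comp _ _ _ snd g); [exact: cvg_snd|exact: cg].
split.
- move=> q; apply: cvgD; first exact: (cs a ca).
  apply: cvgM; last exact: (cs b cb).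
  by apply: (@continuous_max R _ (fun=> 0) (fun q : R * R => q.1));
        [exact: cvg_cst|exact: cvg_fst].
- by move=> t _; apply: cont_add => //; exact: cont_scale.
- by move=> t _; apply: cont_add => //; exact: cont_scale.
- by move=> t x _; exact: (cs b cb).
- move=> t x _ xL; rewrite intD//; last exact: cont_scale.
  by rewrite intZ// (pa x xL) (pb x xL); ring.
- move=> t x _ xL; rewrite intD//; last exact: cont_scale.
  by rewrite intZ// (pa1 x xL) (pb1 x xL) a10 b10; ring.
- by move=> t _; rewrite a1L b1L mulr0 addr0.
- by move=> t x _; apply: is_derive_eq; rewrite /GRing.scale/=; ring.
- by [].
Qed.

Lemma bvec_ext J f (beta gamma : R) : (2 <= J)%N ->
  bvec J L (ext f) beta gamma = bvec J L f beta gamma.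
Proof.
move=> J2.
have nodeL j : (j < J)%N -> clamp L (node J L j) = node J L j.
  move=> jJ; rewrite clamp_id// /node /dx.
  have J0 : 0 < J.-1%:R :> R by rewrite ltr0n; lia.
  rewrite mulr_ge0 ?divr_ge0 ?ler0n//= mulrCA ger_pMr// ler_pdivrMr// mul1r ler_nat.
  by lia.
have rE : rdx J L (ext f) = rdx J L f.
  rewrite /rdx int_ext//; congr (_ * (_ - _ * _)).
  by apply: eq_bigr => j _; rewrite nodeL.
by apply/colP => j; rewrite !mxE rE nodeL.
Qed.

End Extension.

(** * Choice of the comparison function and of the constant *)

Theorem theorem4p1 (R : realType) (L : R) (hL : 0 < L) :
  exists C : R, 0 < C /\
  forall (f : R -> R) (gf : nat -> R -> R) (beta gamma : R),
    C_witness 3 L f gf ->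
    gamma - beta + int_ab 0 L f = 0 ->
  forall (u0 : R -> R) (g0 : nat -> R -> R),
    H_witness 6 L u0 g0 ->
    g0 1%N 0 = beta -> g0 1%N L = gamma ->
    g0 3%N 0 = - gf 1%N 0 -> g0 3%N L = - gf 1%N L ->
    g0 5%N 0 = - gf 3%N 0 -> g0 5%N L = - gf 3%N L ->
  forall u : R -> R -> R, heat_solution L f beta gamma u0 u ->
  forall (J : nat) (dt : R) (v : nat -> 'cV[R]_J),
    (2 <= J)%N -> 0 < dt < 1 -> dt / dx J L ^+ 2 <= 1 / 2 ->
    (forall n, v n.+1 = (1%:M + dt *: Pmat J L) *m v n + dt *: bvec J L f beta gamma) ->
  forall n : nat,
    l2norm (Pi J L (u (n%:R * dt)) - v n)
      <= l2norm (Pi J L u0 - v 0%N)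
         + C * (dx J L + dt) * (Hnorm 5 L g0 + Hnorm 3 L gf).
Proof.
set C := 2 * (Num.sqrt L * (7 + 4 * L)) +
  (L ^+ 2 + 1) * (2 * Num.sqrt (expR 1) * (3 * Num.sqrt L + (Num.sqrt L)^-1)).
have sL0 : 0 < Num.sqrt L by rewrite sqrtr_gt0.
exists C; split.
  apply: addr_gt0.
    by apply: mulr_gt0 => //; apply: mulr_gt0 => //; apply: addr_gt0 => //; exact: mulr_gt0.
  apply: mulr_gt0; first by rewrite addr_gt0 ?exprn_gt0.
  apply: mulr_gt0; first by rewrite mulr_gt0// sqrtr_gt0 expR_gt0.
  by apply: addr_gt0; [exact: mulr_gt0|rewrite invr_gt0].
move=> f gf beta gamma [dcf ccf] comp u0 g0 [dc0 _] b0 bL c0 cL _ _ u sol J dt v J2 dt01 cfl vE n.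
case: J J2 v cfl vE => [//|[//|m]] J2 v cfl vE.
have L0' := ltW hL.
have z0 : (0 : R) <= 0 <= L by rewrite lexx L0'.
have zL : 0 <= L <= L by rewrite lexx L0'.
pose G i x := g0 i (clamp L x); pose F i x := gf i (clamp L x).
have cG i : (i < 6)%N -> continuous (G i) by exact: deriv_chain_cont dc0.
have cF i : (i <= 3)%N -> continuous (F i).
  by move=> i3; apply: cont_clamp => //; exact: ccf.
have pG i : (i < 6)%N -> primitive_on L (G i.+1) (G i) by exact: deriv_chain_primitive dc0.
have pF i : (i < 3)%N -> primitive_on L (F i.+1) (F i) by exact: deriv_chain_primitive dcf.
(* [phi = u0'' + f] is the time derivative that the equation predicts at time 0, and [psi] is its
   second derivative in space. *)
pose phi x := G 2%N x + F 0%N x; pose phi' x := G 3%N x + F 1%N x.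
pose psi x := G 4%N x + F 2%N x.
have cphi : continuous phi by apply: cont_add; [exact: cG|exact: cF].
have cphi' : continuous phi' by apply: cont_add; [exact: cG|exact: cF].
have cpsi : continuous psi by apply: cont_add; [exact: cG|exact: cF].
have pphi : primitive_on L phi' phi.
  move=> x xL; rewrite /phi' intD; [|exact: cG|exact: cF].
  by rewrite /phi (pG 2%N isT x xL) (pF 0%N isT x xL); ring.
have pphi' : primitive_on L psi phi'.
  move=> x xL; rewrite /psi intD; [|exact: cG|exact: cF].
  by rewrite /phi' (pG 3%N isT x xL) (pF 1%N isT x xL); ring.
have fF x : 0 <= x <= L -> F 0%N x = f x by move=> xL; rewrite /F clamp_id//; apply: dcf.1.
have extf : (fun x => f (clamp L x)) = F 0%N.
  by apply/funext => x; rewrite -fF ?clamp_in// /F clamp_id// clamp_in.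
have [UX [UXX [UT HU]]] := neumann_heat_of_solution hL sol; rewrite extf in HU.
pose U t x := u t (clamp L x).
have u00 x : 0 <= x <= L -> u 0 x = u0 x by have [? [? [? H]]] := sol; apply: H.2.2.2.2.2.2.2.1.
have U0 : U 0 = G 0%N.
  apply/funext => x; rewrite /U u00 ?clamp_in// /G.
  by rewrite dc0.1// clamp_in.
have G10 : G 1%N 0 = beta by rewrite /G clamp_id.
have G1L : G 1%N L = gamma by rewrite /G clamp_id.
(* The conditions on the third derivative of [u0] say that [phi] satisfies homogeneous Neumann
   conditions, so that [u0 + t phi] keeps the boundary data of [u]. *)
have p0 : phi' 0 = 0 by rewrite /phi' /G /F clamp_id// c0 addNr.
have pL : phi' L = 0 by rewrite /phi' /G /F clamp_id// cL addNr.
have HV := neumann_heat_affine (cG 0%N isT) (cG 1%N isT) (cG 2%N isT) cphi cphi' cpsi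
  (pG 0%N isT) (pG 1%N isT) pphi pphi' G10 G1L p0 pL.
have := neumann_heat_lin 1 (-1) HU HV.
rewrite !mul1r !mulN1r !subrr.
have -> : (fun t x => 1 * u t (clamp L x) + (-1) * (G 0%N x + t * phi x)) =
    (fun t x => U t x - U 0 x - t * phi x).
  by apply/funext => t; apply/funext => x; rewrite U0 /U; ring.
have -> : (fun t x : R => 1 * F 0%N x + (-1) * (phi x - (G 2%N x + t * psi x))) =
    (fun t x => t * psi x).
  by apply/funext => t; apply/funext => x; rewrite /phi; ring.
move=> HW.
set N := Hnorm 5 L g0 + Hnorm 3 L gf.
have h0 := Hnorm_ge0 L 5 g0; have hf := Hnorm_ge0 L 3 gf.
have N0 : 0 <= N by rewrite addr_ge0.
have sG i : (i <= 5)%N -> sqint L (G i) <= Hnorm 5 L g0 ^+ 2 by exact: sqint_Hnorm.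
have sF i : (i <= 3)%N -> sqint L (F i) <= Hnorm 3 L gf ^+ 2 by exact: sqint_Hnorm.
have sN : Hnorm 5 L g0 ^+ 2 + Hnorm 3 L gf ^+ 2 <= N ^+ 2 by rewrite /N; nra.
have sFN i : (i <= 3)%N -> sqint L (F i) <= N ^+ 2.
  by move=> /sF h; apply: le_trans h _; have := sqr_ge0 (Hnorm 5 L g0); lra.
have phiN : sqint L phi <= 2 * N ^+ 2.
  apply: le_trans (sqint_le2 (cG 2%N isT) (cF 0%N isT) cphi _) _ => //.
  by have := sG 2%N isT; have := sF 0%N isT; lra.
have psiN : sqint L psi <= 2 * N ^+ 2.
  apply: le_trans (sqint_le2 (cG 4%N isT) (cF 2%N isT) cpsi _) _ => //.
  by have := sG 4%N isT; have := sF 2%N isT; lra.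
have compF : gamma - beta + int_ab 0 L (F 0%N) = 0.
  by rewrite (eq_int fF).
have vE' k : v k.+1 = (1%:M + dt *: Pmat m.+2 L) *m v k + dt *: bvec m.+2 L (F 0%N) beta gamma.
  by rewrite -extf bvec_ext.
have U0x : primitive_on L (G 1%N) (U 0) by rewrite U0; exact: pG.
have UX0x : primitive_on L (fun x => phi x - F 0%N x) (G 1%N).
  have -> : (fun x => phi x - F 0%N x) = G 2%N by apply/funext => x; rewrite /phi addrK.
  exact: pG.
have := scheme_error hL HU HW (cF 0%N isT) (cF 1%N isT) (pF 0%N isT) cphi cpsi
  (cG 1%N isT) U0x UX0x G10 G1L compF N0 phiN psiN (sFN 0%N isT) (sFN 1%N isT) dt01 cfl vE' n.
have nodeL (j : 'I_m.+2) : 0 <= node m.+2 L j <= L.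
  rewrite /node /dx mulr_ge0 ?divr_ge0 ?ler0n//= mulrCA ger_pMr//.
  by rewrite ler_pdivrMr ?ltr0Sn// mul1r ler_nat -ltnS.
have PiE w : \col_(j < m.+2) w (clamp L (node m.+2 L j)) = Pi m.+2 L w.
  by apply/colP => j; rewrite !mxE clamp_id.
rewrite !PiE.
have -> // : Pi m.+2 L (u 0) = Pi m.+2 L u0.
by apply/colP => j; rewrite !mxE u00.
Qed.
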